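(* Let $n\ge 3$ be odd. Then $\{\mathcal{F}_C : C \text{ is a self-dual code in } \mathbb{F}_2^{n+1}\}$ is a partition of $\mathcal{SD}_n$; i.e. each $\mathcal{F}_C\subseteq\mathcal{SD}_n$, $\mathcal{F}_C\cap\mathcal{F}_{\widetilde C}=\emptyset$ for distinct self-dual codes $C\neq\widetilde C$, and every element of $\mathcal{SD}_n$ lies in some $\mathcal{F}_C$.
   Context: $\mathbb{F}_2$ is the binary field; $\mathrm{SGL}_n(\mathbb{F}_2)$ is the set of invertible symmetric $n\times n$ matrices over $\mathbb{F}_2$; $\Gamma_n$ is the graph on $\mathrm{SGL}_n(\mathbb{F}_2)$ with $A\sim B$ iff $\mathrm{rank}(A-B)=1$, $d$ its graph distance. $\mathcal{SD}_n=\{A\in\mathrm{SGL}_n(\mathbb{F}_2): d(A,I_n)=\frac{n+5}{2},\ \mathrm{rank}(A-I_n)=\frac{n+1}{2}\}$. A code $C\subseteq\mathbb{F}_2^{n+1}$ is self-dual if $C=C^\perp$ (standard dot product); then $\dim C=m:=\frac{n+1}{2}$. For $\mathbf{y}\in\mathbb{F}_2^{n+1}$, $\underline{\mathbf{y}}\in\mathbb{F}_2^n$ is $\mathbf{y}$ with its last entry deleted; $\mathbf{x}^2:=\mathbf{x}\mathbf{x}^{\top}$. Let $\mathfrak{B}_C$ be the set of bases of $C$, $\mathfrak{B}_C^2$ those bases containing an even number of vectors with last entry $1$. For $\mathcal{B}=\{\mathbf{y}_1,\ldots,\mathbf{y}_m\}\in\mathfrak{B}_C$ put $A'_{\mathcal{B}}=I_n+\sum_{i=1}^m\underline{\mathbf{y}_i}^2$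 and $A''_{\mathcal{B}}=I_n+\sum_{i=1}^m\underline{\mathbf{y}_i}^2+(\underline{\mathbf{y}_1}+\cdots+\underline{\mathbf{y}_m})^2$. Define $\mathcal{F}_C=\{A'_{\mathcal{B}}:\mathcal{B}\in\mathfrak{B}_C^2\}\cup\{A''_{\mathcal{B}}:\mathcal{B}\in\mathfrak{B}_C\}$ if $m$ is even, and $\mathcal{F}_C=\{A'_{\mathcal{B}}:\mathcal{B}\in\mathfrak{B}_C^2\}$ if $m$ is odd. *)

(* Defs.v *)
From mathcomp Require Import all_boot all_order all_algebra.
Set Implicit Arguments. Unset Strict Implicit. Unset Printing Implicit Defensive.
Import GRing.Theory.
Local Open Scope ring_scope.

Notation F2 := 'F_2.

Definition sgl (n : nat) (A : 'M[F2]_n) : bool := (A^T == A) && (A \in unitmx).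

Fixpoint walk (n k : nat) (A B : 'M[F2]_n) : Prop :=
  match k with
  | 0 => A = B
  | k'.+1 => exists C : 'M[F2]_n, sgl C /\ \rank (A - C) = 1%N /\ walk k' C B
  end.

Definition gdist_is (n : nat) (A B : 'M[F2]_n) (k : nat) : Prop :=
  walk k A B /\ forall j, (j < k)%N -> ~ walk j A B.

Definition in_SD (n : nat) (A : 'M[F2]_n) : Prop :=
  sgl A /\ gdist_is A 1%:M (n + 5)./2 /\ \rank (A - 1%:M) = (n + 1)./2.

Definition dotv (N : nat) (x y : 'rV[F2]_N) : F2 := (x *m y^T) 0 0.

Definition dual_code (N : nat) (C : {set 'rV[F2]_N}) : {set 'rV[F2]_N} :=
  [set y | [forall x in C, dotv x y == 0]].

Definition self_dual (N : nat) (C : {set 'rV[F2]_N}) : Prop := C = dual_code C.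

Definition under (n : nat) (y : 'rV[F2]_n.+1) : 'rV[F2]_n :=
  \row_(j < n) y 0 (widen_ord (leqnSn n) j).

(* x^2 := x x^T, x a (column) vector of F_2^n *)
Definition vsq (n : nat) (x : 'rV[F2]_n) : 'M[F2]_n := x^T *m x.

Definition fam_mx (m N : nat) (B : 'I_m -> 'rV[F2]_N) : 'M[F2]_(m, N) :=
  \matrix_(i < m) B i.

Definition is_basis (m N : nat) (C : {set 'rV[F2]_N}) (B : 'I_m -> 'rV[F2]_N) : Prop :=
  row_free (fam_mx B) /\ (forall y : 'rV[F2]_N, y \in C <-> (y <= fam_mx B)%MS).

Definition even_last (m n : nat) (B : 'I_m -> 'rV[F2]_n.+1) : bool :=
  ~~ odd #|[set i : 'I_m | B i 0 ord_max == 1]|.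

Definition A1 (m n : nat) (B : 'I_m -> 'rV[F2]_n.+1) : 'M[F2]_n :=
  1%:M + \sum_(i < m) vsq (under (B i)).

Definition A2 (m n : nat) (B : 'I_m -> 'rV[F2]_n.+1) : 'M[F2]_n :=
  1%:M + \sum_(i < m) vsq (under (B i)) + vsq (\sum_(i < m) under (B i)).

Definition in_FC (n : nat) (C : {set 'rV[F2]_n.+1}) (A : 'M[F2]_n) : Prop :=
  let m := (n + 1)./2 in
  (exists B : 'I_m -> 'rV[F2]_n.+1, is_basis C B /\ even_last B /\ A = A1 B)
  \/ (~~ odd m /\ exists B : 'I_m -> 'rV[F2]_n.+1, is_basis C B /\ A = A2 B).

(* Main.v *)
Require Import Defs.
From mathcomp Require Import all_boot all_order all_algebra.
Set Implicit Arguments. Unset Strict Implicit. Unset Printing Implicit Defensive.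
Import GRing.Theory.
Local Open Scope ring_scope.

(* Put m = (n + 1) / 2, D = A - I and let U be the row space of D, of dimension m.
   Walks of length k from A to I are the decompositions D = z_1^2 + ... + z_k^2 all of
   whose partial sums stay invertible after adding I.  Call U flat if
   u.v = (u.u)(v.v) on U; this says that appending the parity bit u.u embeds U as a
   self-orthogonal code of length 2m, and C is recovered from A in this way.

   If U is flat and contains a vector of odd weight, a walk of length <= m + 1 has all
   its z_i in U, and the first z_i of odd weight would be a kernel vector; so the distance
   is at least m + 2, and explicit walks of this length exist.

   If U is not flat, write D = T^T T with m + 1 rows in T.  With G = T T^T, invertibility
   of the partial sums means that the leading minors of I + G are nonzero, for some choice
   of T up to a left orthogonal factor.  One peels off a unit vector x with G(x, x) = 0,
   replacing G by its Schur complement, and counting shows that x can be chosen so that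
   the reduced pair is still not alternate and not flat.  This gives a walk of length at
   most m + 1.  Finally D is diagonalised over F_2 as a sum of m squares, or, when it is
   alternate, of m + 1 squares with zero sum. *)

(** * Arithmetic of F_2 and of matrices in characteristic 2 *)

Lemma F2P (a : F2) : a = 0 \/ a = 1.
Proof. by case: a => [[|[|a]] // lt_a]; [left | right]; apply: val_inj. Qed.

Lemma F2_addxx (a : F2) : a + a = 0.
Proof. by case: (F2P a) => ->; apply/eqP. Qed.

Lemma F2_mulxx (a : F2) : a * a = a.
Proof. by case: (F2P a) => ->; apply/eqP. Qed.

Lemma F2_oppx (a : F2) : - a = a.
Proof. by case: (F2P a) => ->; apply/eqP. Qed.

Lemma F2_addK (a b : F2) : a + (a + b) = b.
Proof. by rewrite addrA F2_addxx add0r. Qed.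

Lemma F2_add_eq0 (a b : F2) : a + b = 0 -> a = b.
Proof. by case: (F2P a) => ->; case: (F2P b) => -> // /eqP. Qed.

Lemma F2_neq_add (a b : F2) : a <> b -> a + b = 1.
Proof. by case: (F2P a) => ->; case: (F2P b) => -> // _; apply/eqP. Qed.

Lemma F2_natr (k : nat) : k%:R = (odd k)%:R :> F2.
Proof.
elim: k => //= k IHk; rewrite mulrS IHk.
by case: (odd k); apply/eqP.
Qed.

Lemma mx_addxx m n (A : 'M[F2]_(m, n)) : A + A = 0.
Proof. by apply/matrixP => i j; rewrite !mxE F2_addxx. Qed.

Lemma mx_oppx m n (A : 'M[F2]_(m, n)) : - A = A.
Proof. by apply/matrixP => i j; rewrite !mxE F2_oppx. Qed.

Lemma mx_addK m n (A B : 'M[F2]_(m, n)) : A + (A + B) = B.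
Proof. by rewrite addrA mx_addxx add0r. Qed.

Lemma mx_add_eq0 m n (A B : 'M[F2]_(m, n)) : A + B = 0 -> A = B.
Proof. by move/eqP; rewrite addr_eq0 mx_oppx => /eqP. Qed.

(** * Bilinear forms over the binary field *)

Definition bform k (K : 'M[F2]_k) (u v : 'rV[F2]_k) : F2 := (u *m K *m v^T) 0 0.

Lemma bformDl k (K : 'M[F2]_k) u1 u2 v :
  bform K (u1 + u2) v = bform K u1 v + bform K u2 v.
Proof. by rewrite /bform !mulmxDl mxE. Qed.

Lemma bformDr k (K : 'M[F2]_k) u v1 v2 :
  bform K u (v1 + v2) = bform K u v1 + bform K u v2.
Proof. by rewrite /bform linearD /= mulmxDr mxE. Qed.

Lemma bformZl k (K : 'M[F2]_k) a u v : bform K (a *: u) v = a * bform K u v.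
Proof. by rewrite /bform -!scalemxAl mxE. Qed.

Lemma bformZr k (K : 'M[F2]_k) a u v : bform K u (a *: v) = a * bform K u v.
Proof. by rewrite /bform linearZ -scalemxAr mxE. Qed.

Lemma bform_addl k (K L : 'M[F2]_k) u v : bform (K + L) u v = bform K u v + bform L u v.
Proof. by rewrite /bform mulmxDr mulmxDl mxE. Qed.

Lemma bformC k (K : 'M[F2]_k) u v : K^T = K -> bform K u v = bform K v u.
Proof.
move=> symK; rewrite /bform.
have -> : u *m K *m v^T = (v *m K *m u^T)^T by rewrite !trmx_mul trmxK symK mulmxA.
by rewrite mxE.
Qed.

Lemma bform0l k (K : 'M[F2]_k) v : bform K 0 v = 0.
Proof. by rewrite /bform !mul0mx mxE. Qed.

Lemma bform_mx k l (P : 'M[F2]_(l, k)) (K : 'M[F2]_k) u v :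
  bform (P *m K *m P^T) u v = bform K (u *m P) (v *m P).
Proof. by rewrite /bform trmx_mul !mulmxA. Qed.

Lemma bform_delta k (K : 'M[F2]_k) i j : bform K (delta_mx 0 i) (delta_mx 0 j) = K i j.
Proof. by rewrite /bform -rowE trmx_delta -colE !mxE. Qed.

Lemma dotvE k (u v : 'rV[F2]_k) : dotv u v = bform 1%:M u v.
Proof. by rewrite /bform mulmx1. Qed.

Lemma bform_dotv k (K : 'M[F2]_k) u v : bform K u v = dotv (u *m K) v.
Proof. by []. Qed.

Lemma dotvC k (u v : 'rV[F2]_k) : dotv u v = dotv v u.
Proof. by rewrite !dotvE bformC ?trmx1. Qed.

Lemma dotvDl k (u1 u2 v : 'rV[F2]_k) : dotv (u1 + u2) v = dotv u1 v + dotv u2 v.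
Proof. by rewrite !dotvE bformDl. Qed.

Lemma dotvDr k (u v1 v2 : 'rV[F2]_k) : dotv u (v1 + v2) = dotv u v1 + dotv u v2.
Proof. by rewrite !dotvE bformDr. Qed.

Lemma dotvZl k a (u v : 'rV[F2]_k) : dotv (a *: u) v = a * dotv u v.
Proof. by rewrite !dotvE bformZl. Qed.

Lemma dot0v k (v : 'rV[F2]_k) : dotv 0 v = 0.
Proof. by rewrite dotvE bform0l. Qed.

Lemma dotv_suml k I (r : seq I) (P : pred I) (F : I -> 'rV[F2]_k) v :
  dotv (\sum_(i <- r | P i) F i) v = \sum_(i <- r | P i) dotv (F i) v.
Proof. by rewrite /dotv mulmx_suml summxE. Qed.

Lemma mul_dotv k l (u v : 'rV[F2]_k) (w : 'rV[F2]_l) : u *m v^T *m w = dotv u v *: w.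
Proof. by rewrite [u *m v^T]mx11_scalar mul_scalar_mx. Qed.

Lemma dotv_sum k (u v : 'rV[F2]_k) : dotv u v = \sum_i u 0 i * v 0 i.
Proof. by rewrite /dotv mxE; apply: eq_bigr => i _; rewrite mxE. Qed.

Lemma dotv_delta k (u : 'rV[F2]_k) i : dotv u (delta_mx 0 i) = u 0 i.
Proof. by rewrite /dotv trmx_delta -colE mxE. Qed.

Lemma dotv_inj k (u v : 'rV[F2]_k) : (forall w, dotv u w = dotv v w) -> u = v.
Proof.
by move=> eq_uv; apply/rowP => i; have := eq_uv (delta_mx 0 i); rewrite !dotv_delta.
Qed.

Definition diagv k (K : 'M[F2]_k) : 'rV[F2]_k := \row_i K i i.

(* The off-diagonal terms of a symmetric double sum cancel in pairs. *)
Lemma sum_sym k (F : 'I_k -> 'I_k -> F2) :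
  (forall i j, F i j = F j i) -> \sum_i \sum_j F i j = \sum_i F i i.
Proof.
elim: k F => [|k IHk] F symF; first by rewrite !big_ord0.
rewrite big_ord_recl [RHS]big_ord_recl big_ord_recl -addrA; congr (_ + _).
under [X in _ + X]eq_bigr => i _ do rewrite big_ord_recl symF.
by rewrite big_split /= F2_addK; apply: IHk => i j; apply: symF.
Qed.

(** Squaring is the identity on F_2, so for symmetric K the quadratic form K(u, u) is a linear
    functional, represented by the diagonal. Every condition of the form K(x, x) = a below is
    thereby one linear equation. *)
Lemma bform_diag k (K : 'M[F2]_k) u : K^T = K -> bform K u u = dotv u (diagv K).
Proof.
move=> symK; rewrite dotv_sum /bform mxE.
under eq_bigr => j _ do rewrite !mxE big_distrl /=.
rewrite (sum_sym (F := fun j i => u 0 i * K i j * u 0 j)).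
  by apply: eq_bigr => i _; rewrite !mxE mulrAC F2_mulxx.
by move=> i j; rewrite -[in LHS]symK mxE mulrAC [RHS]mulrAC (mulrC (u 0 i)).
Qed.

Lemma dotv_diag k (u : 'rV[F2]_k) : dotv u u = dotv u (const_mx 1).
Proof.
rewrite [LHS]dotvE bform_diag ?trmx1 //; congr dotv.
by apply/rowP => i; rewrite !mxE eqxx.
Qed.

Lemma bformDD k (K : 'M[F2]_k) u v : K^T = K ->
  bform K (u + v) (u + v) = bform K u u + bform K v v.
Proof. by move=> symK; rewrite !bform_diag ?dotvDl. Qed.

Lemma dotvDD k (u v : 'rV[F2]_k) : dotv (u + v) (u + v) = dotv u u + dotv v v.
Proof. by rewrite !dotvE bformDD ?trmx1. Qed.

(** * Kernels, nondegenerate forms and orthonormal bases *)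

Lemma row_free_ker m n (A : 'M[F2]_(m, n)) :
  (forall v : 'rV_m, v *m A = 0 -> v = 0) -> row_free A.
Proof.
move=> kerA; rewrite -kermx_eq0; apply/eqP/row_matrixP => i.
by rewrite row0; apply: kerA; rewrite -row_mul mulmx_ker row0.
Qed.

Lemma unitmx_ker k (A : 'M[F2]_k) :
  (forall v : 'rV_k, v *m A = 0 -> v = 0) -> A \in unitmx.
Proof.
by rewrite -row_free_unit; apply: row_free_ker.
Qed.

Lemma unitmx_inj k l (A : 'M[F2]_k) (v : 'M_(l, k)) : A \in unitmx -> v *m A = 0 -> v = 0.
Proof. by move=> uA vA; rewrite -[v](mulmxK uA) vA mul0mx. Qed.

Lemma trmx_invmx k (A : 'M[F2]_k) : A^T = A -> (invmx A)^T = invmx A.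
Proof. by rewrite trmx_inv => ->. Qed.

Lemma trmx_congruence k l (P : 'M[F2]_(l, k)) (K : 'M[F2]_k) :
  K^T = K -> (P *m K *m P^T)^T = P *m K *m P^T.
Proof. by move=> symK; rewrite !trmx_mul trmxK symK mulmxA. Qed.

(* tr (K K^-1) only sees the diagonals, by symmetry. *)
Lemma bform_inv_diag k (K : 'M[F2]_k) : K^T = K -> K \in unitmx ->
  bform (invmx K) (diagv K) (diagv K) = k%:R.
Proof.
move=> symK uK; have symV := trmx_invmx symK.
rewrite bform_diag // -(mxtrace1 _ k) -(mulmxV uK) /mxtrace.
under [RHS]eq_bigr => i _ do rewrite mxE.
rewrite [RHS](sum_sym (F := fun i j => K i j * invmx K j i)).
  by rewrite dotv_sum; apply: eq_bigr => i _; rewrite !mxE.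
move=> i j; have symP (A : 'M[F2]_k) : A^T = A -> A i j = A j i.
  by move=> symA; rewrite -[in LHS]symA mxE.
by rewrite !symP.
Qed.

Lemma unit_alternate_even k (K : 'M[F2]_k) : K^T = K -> K \in unitmx ->
  diagv K = 0 -> ~~ odd k.
Proof.
move=> symK uK K0; have := bform_inv_diag symK uK; rewrite K0 bform0l F2_natr.
by case: (odd k).
Qed.

Lemma alternateP k (K : 'M[F2]_k) : K^T = K ->
  diagv K = 0 \/ exists x, bform K x x = 1.
Proof.
move=> symK; case: (pickP (fun i => K i i == 1)) => [i /eqP Kii | K0]; last first.
  by left; apply/rowP => i; rewrite !mxE; case: (F2P (K i i)) (K0 i) => ->.
by right; exists (delta_mx 0 i); rewrite bform_delta.
Qed.

(** The solutions form a coset of the kernel of [W], of dimension at least k - p since [W] has p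
    columns; a list shorter than 2^(k - p) cannot cover it. *)
Lemma solution_notin k p (W : 'M[F2]_(k, p)) (x0 : 'rV[F2]_k) (L : seq 'rV[F2]_k) :
  (size L < 2 ^ (k - p))%N -> exists x, x *m W = x0 *m W /\ x \notin L.
Proof.
move=> ltL; pose r := \rank (kermx W).
pose f (c : 'rV[F2]_r) := x0 + c *m row_base (kermx W).
have f_inj : injective f.
  by move=> c d /addrI /(row_free_inj (row_base_free _)).
case: (pickP (fun c => f c \notin L)) => [c fcL | fL].
  exists (f c); split=> //; rewrite mulmxDl -mulmxA.
  by have /sub_kermxP-> : (row_base (kermx W) <= kermx W)%MS; rewrite ?eq_row_base ?mulmx0 ?addr0.
have le_rL : (2 ^ r <= size L)%N.
  have := @uniq_leq_size _ (codom f) L; rewrite size_codom card_mx card_ord mul1n.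
  apply; first by apply/injectiveP.
  by move=> _ /codomP[c ->]; have := fL c; case: (f c \in L).
suff: (2 ^ r < 2 ^ r)%N by rewrite ltnn.
apply: leq_ltn_trans le_rL (leq_trans ltL _).
by rewrite leq_exp2l // /r mxrank_ker leq_sub2l // rank_leq_col.
Qed.

(** As K(x, x) = 1, the space is the orthogonal sum of the line of x and its complement, so the
    restriction of K to the complement stays nondegenerate. The rows of [N] are a basis of that
    complement. *)
Lemma orthogonal_complement k (K : 'M[F2]_k.+1) (x : 'rV[F2]_k.+1) :
    K^T = K -> K \in unitmx -> bform K x x = 1 ->
  exists N : 'M[F2]_(k, k.+1),
    [/\ N *m K *m x^T = 0, forall u, bform K u x = 0 -> exists a, u = a *m N
      & N *m K *m N^T \in unitmx].
Proof.
move=> symK uK Kxx; have rkx : \rank (kermx (K *m x^T)) = k.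
  rewrite mxrank_ker; suff -> : \rank (K *m x^T) = 1%N by rewrite subn1.
  apply/eqP; rewrite eqn_leq rank_leq_col lt0n mxrank_eq0; apply/eqP => Kx0.
  by move: Kxx; rewrite /bform -mulmxA Kx0 mulmx0 mxE.
have: exists N : 'M[F2]_(\rank (kermx (K *m x^T)), k.+1),
    row_free N /\ (N :=: kermx (K *m x^T))%MS.
  by exists (row_base (kermx (K *m x^T))); split; [apply: row_base_free | apply: eq_row_base].
rewrite rkx => -[N [freeN eqN]]; exists N.
have spanN u : bform K u x = 0 -> exists a, u = a *m N.
  move=> u0; apply/submxP; rewrite eqN; apply/sub_kermxP.
  by rewrite mulmxA [LHS]mx11_scalar -[_ 0 0]/(bform K u x) u0 raddf0.
have Nx : N *m K *m x^T = 0.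
  by rewrite -mulmxA; apply/sub_kermxP; rewrite -eqN.
split=> //; apply: unitmx_ker => a aN.
have perp u : bform K (a *m N) u = 0.
  have -> : u = bform K u x *: x + (u + bform K u x *: x).
    by rewrite addrC -addrA mx_addxx addr0.
  have [|b ->] := spanN (u + bform K u x *: x).
    by rewrite bformDl bformZl Kxx mulr1 F2_addxx.
  rewrite bformDr bformZr {2}/bform -!mulmxA (mulmxA N) Nx mulmx0 mxE mulr0 add0r.
  by rewrite -bform_mx /bform aN mul0mx mxE.
have /(unitmx_inj uK) : a *m N *m K = 0.
  by apply: dotv_inj => u; rewrite dot0v -bform_dotv perp.
by move/eqP; rewrite mulmx_free_eq0 // => /eqP.
Qed.

(* A nondegenerate form has a unique characteristic vector z, with K(u, z) = K(u, u);
   the orthogonal complement of x <> z is not alternate. *)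
Lemma nonalternate_complement k (K : 'M[F2]_k) (x : 'rV[F2]_k) :
    K^T = K -> bform K x x = 1 -> x *m K <> diagv K ->
  exists u, bform K u x = 0 /\ bform K u u = 1.
Proof.
move=> symK Kxx neqx.
case: (pickP (fun i => (x *m K) 0 i != diagv K 0 i)) => [i neqi | eqx]; last first.
  by case: neqx; apply/rowP => i; apply/eqP; have := eqx i; case: eqP.
pose w : 'rV[F2]_k := delta_mx 0 i; exists (w + bform K w x *: x); split.
  by rewrite bformDl bformZl Kxx mulr1 F2_addxx.
rewrite bformDD // bformZl bformZr mulrA F2_mulxx Kxx mulr1.
have -> : bform K w w = diagv K 0 i by rewrite bform_diag // dotvC dotv_delta.
have -> : bform K w x = (x *m K) 0 i by rewrite bformC // bform_dotv dotv_delta.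
move: neqi; case: (F2P (diagv K 0 i)) => ->; case: (F2P ((x *m K) 0 i)) => -> // _; apply/eqP => //.
Qed.

Lemma orthonormal_basis k (K : 'M[F2]_k) : K^T = K -> K \in unitmx ->
  k = 0%N \/ (exists x, bform K x x = 1) -> exists P : 'M[F2]_k, P *m K *m P^T = 1%:M.
Proof.
elim: k K => [|k IHk] K symK uK; first by exists 0; apply/matrixP => -[].
case=> // -[x0 Kx0].
(* For k > 0 the equation K(x, x) = 1 has at least two solutions; one of them differs from the
   characteristic vector [diagv K *m invmx K], so its complement is again not alternate and the
   induction continues. *)
have [x Kxx x_k] : exists2 x, bform K x x = 1 & k = 0%N \/ x *m K <> diagv K.
  have [k0 | k_gt0] := posnP k; first by exists x0; [|left].
  have [|x [xW xL]] := @solution_notin k.+1 1 (diagv K)^T x0 [:: diagv K *m invmx K].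
    by rewrite subn1 /= -{1}(expn0 2) ltn_exp2l.
  exists x; first by rewrite bform_diag // /dotv xW -/(dotv _ _) -bform_diag.
  right=> xK; move: xL; rewrite inE -xK mulmxK // eqxx //.
have [N [Nx spanN uN]] := orthogonal_complement symK uK Kxx.
have [|||P1 P1K] := IHk (N *m K *m N^T).
- exact: trmx_congruence.
- by [].
- case: x_k => [k0 | x_k]; [by left | right].
  have [u [ux uu]] := nonalternate_complement symK Kxx x_k.
  by have [a ua] := spanN u ux; exists a; rewrite bform_mx -ua.
exists (col_mx x (P1 *m N)).
have Nx' : x *m K *m N^T = 0.
  by apply: (can_inj (@trmxK _ _ _)); rewrite !trmx_mul trmxK symK mulmxA Nx trmx0.
rewrite (@mul_col_mx _ 1 k) (@tr_col_mx _ 1 k) (@mul_col_row _ 1 k k.+1 1 k).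
rewrite (@scalar_mx_block _ 1 k); congr (@block_mx _ 1 k 1 k _ _ _ _).
- by rewrite [LHS]mx11_scalar -[_ 0 0]/(bform K x x) Kxx.
- by rewrite trmx_mul mulmxA Nx' mul0mx.
- by rewrite -!mulmxA (mulmxA N) Nx mulmx0.
- by rewrite trmx_mul mulmxA -(mulmxA P1) -(mulmxA P1).
Qed.

(** For the dot product the characteristic vector is the all-ones vector, which explains the
    exclusion. The rows of [Q] are an orthonormal basis of the complement of x, and the last
    identity resolves the identity along x and [Q]. *)
Lemma orthonormal_completion k (x : 'rV[F2]_k.+1) : dotv x x = 1 ->
    k = 0%N \/ x <> const_mx 1 ->
  exists Q : 'M[F2]_(k, k.+1),
    [/\ Q *m Q^T = 1%:M, Q *m x^T = 0 & x^T *m x + Q^T *m Q = 1%:M].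
Proof.
move=> xx x_k; have sym1 := trmx1 F2 k.+1; have xx1 : bform 1%:M x x = 1 by rewrite -dotvE.
have [N [Nx spanN uN]] := orthogonal_complement sym1 (unitmx1 _ _) xx1.
rewrite mulmx1 in Nx uN.
have [|||P PN] := @orthonormal_basis k (N *m N^T).
- by rewrite trmx_mul trmxK.
- by [].
- case: x_k => [k0 | x_k]; [by left | right].
  have [|u [ux uu]] := nonalternate_complement sym1 xx1.
    rewrite mulmx1 => x1; case: x_k; rewrite x1.
    by apply/rowP => i; rewrite !mxE eqxx.
  by have [a ua] := spanN u ux; exists a; have := bform_mx N 1%:M a a; rewrite mulmx1 -ua => ->.
have uP : P \in unitmx.
  have: P *m (N *m N^T *m P^T) = 1%:M by rewrite mulmxA.
  by case/mulmx1_unit.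
have QQ : P *m N *m (P *m N)^T = 1%:M by rewrite trmx_mul !mulmxA -(mulmxA P).
have Qx : P *m N *m x^T = 0 by rewrite -mulmxA Nx mulmx0.
exists (P *m N); split=> //; apply/row_matrixP => i; rewrite row1 rowE.
set u := delta_mx 0 i; rewrite mulmxDr !mulmxA mul_dotv.
have [|a ua] := spanN (u + dotv u x *: x).
  by rewrite -dotvE dotvDl dotvZl xx mulr1 F2_addxx.
have uQ : u *m (P *m N)^T = a *m invmx P.
  have -> : u = a *m invmx P *m (P *m N) + dotv u x *: x.
    by rewrite mulmxA mulmxKV // -ua -addrA mx_addxx addr0.
  rewrite mulmxDl -mulmxA QQ mulmx1 -scalemxAl.
  have -> : x *m (P *m N)^T = (P *m N *m x^T)^T by rewrite [RHS]trmx_mul trmxK.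
  by rewrite Qx trmx0 scaler0 addr0.
by rewrite -(mulmxA _ P N) uQ mulmxA mulmxKV // -ua addrCA mx_addxx addr0.
Qed.

(** * Choosing the vector to peel off *)

Ltac f2_split :=
  repeat match goal with
  | a : _ |- _ => let H := fresh in destruct (F2P a) as [H | H]; subst a
  end.

Ltac f2_close :=
  repeat match goal with H : _ = _ |- _ => try (by move/eqP: H); clear H end; by apply/eqP.

Ltac f2 := f2_split; intros; f2_close.

(** The defect of flatness: for G = T T^T it sends (a, b) to u.v + (u.u)(v.v) with u = aT and v =
    bT, so it vanishes exactly when the row space of T is flat. *)
Definition alt_part k (G : 'M[F2]_k) : 'M[F2]_k := G + (diagv G)^T *m diagv G.

Lemma bform_alt k (G : 'M[F2]_k) u v : G^T = G ->
  bform (alt_part G) u v = bform G u v + bform G u u * bform G v v.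
Proof.
move=> symG; rewrite bform_addl; congr (_ + _).
by rewrite bform_dotv mulmxA mul_dotv dotvZl !bform_diag // [in RHS](dotvC v).
Qed.

Lemma bform_col_sq k (w u v : 'rV[F2]_k) : bform (w^T *m w) u v = dotv u w * dotv v w.
Proof. by rewrite bform_dotv mulmxA mul_dotv dotvZl (dotvC w). Qed.

Section Peeling.

Variables (k : nat) (G : 'M[F2]_k).
Hypotheses (symG : G^T = G).

Let symH : (1%:M + G)^T = 1%:M + G.
Proof. by rewrite linearD /= trmx1 symG. Qed.

Let H_diag u : bform (1%:M + G) u u = dotv u u + bform G u u.
Proof. by rewrite bform_addl -dotvE. Qed.

(** The reduced form on the dot-complement of x is G(u, v) + G(u, x) G(v, x); the conclusion says
    that identity plus reduced form is not alternate there. The witness comes from the complement of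
    x for I + G, projected onto the dot-complement along x. *)
Lemma nonalternate_peel x : dotv x x = 1 -> bform G x x = 0 ->
    x *m (1%:M + G) <> diagv (1%:M + G) ->
  exists u, dotv u x = 0 /\ bform (1%:M + G) u u + bform G u x = 1.
Proof.
move=> xx Gxx neqx; have Hxx : bform (1%:M + G) x x = 1 by rewrite H_diag xx Gxx addr0.
have [w [wx ww]] := nonalternate_complement symH Hxx neqx.
exists (w + dotv w x *: x); split.
  by rewrite dotvDl dotvZl xx mulr1 F2_addxx.
rewrite bformDD // bformZl bformZr Hxx ww bformDl bformZl Gxx.
move: wx; rewrite bform_addl -dotvE; move: (dotv w x) (bform G w x) => a b.
clear; f2.
Qed.

(* Otherwise x + diag G would lie in the span of the functionals alt_part G (u0, -)
   and alt_part G (v0, -); it cannot vanish, as diag G itself satisfies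
   z.z = G(z, z). *)
Lemma alt_part_peel x u0 v0 (b := fun w => w *m alt_part G) :
    dotv x x = 1 -> bform G x x = 0 -> bform (alt_part G) u0 v0 = 1 ->
    x \notin [:: diagv G + b u0; diagv G + b v0; diagv G + b u0 + b v0] ->
  exists u v, [/\ dotv u x = 0, dotv v x = 0 &
    bform G u v + bform G u x * bform G v x <>
    (bform G u u + bform G u x) * (bform G v v + bform G v x)].
Proof.
move=> xx Gxx b1.
case: (boolP [exists u, exists v, [&& dotv u x == 0, dotv v x == 0 &
    bform G u v + bform G u x * bform G v x !=
    (bform G u u + bform G u x) * (bform G v v + bform G v x)]]).
  by case/existsP=> u /existsP[v /and3P[/eqP ux /eqP vx /eqP uv]] _; exists u, v.
move=> noex; have flat u v : dotv u x = 0 -> dotv v x = 0 ->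
    bform G u v + bform G u x * bform G v x =
    (bform G u u + bform G u x) * (bform G v v + bform G v x).
  move=> ux vx; apply/eqP; apply: contraNT noex => uv.
  by apply/existsP; exists u; apply/existsP; exists v; rewrite ux vx !eqxx.
pose mu u := dotv u x + bform G u u.
(* Flatness of the reduced form is applied to the projections of u and v along x and expanded. *)
have altE u v : bform (alt_part G) u v = mu u * bform G v x + mu v * bform G u x.
  have perp w : dotv (w + dotv w x *: x) x = 0.
    by rewrite dotvDl dotvZl xx mulr1 F2_addxx.
  have := flat _ _ (perp u) (perp v); rewrite bform_alt // /mu !bformDD //.
  rewrite !(bformDl, bformDr, bformZl, bformZr) Gxx (bformC x v symG).
  move: (bform G u v) (bform G u u) (bform G v v) (dotv u x) (dotv v x) (bform G u x) (bform G v x).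
  clear => uv uu vv ux vx gu gv; f2.
(* Cramer's rule for the two functionals [mu] and G(-, x), whose determinant at [u0], [v0] is 1 by
   [b1]. *)
have muE w : mu w = mu v0 * bform (alt_part G) u0 w + mu u0 * bform (alt_part G) v0 w.
  move: b1; rewrite !altE.
  move: (mu w) (mu u0) (mu v0) (bform G w x) (bform G u0 x) (bform G v0 x).
  clear => a a1 a2 c c1 c2; f2.
have xE : x = diagv G + (mu v0 *: b u0 + mu u0 *: b v0).
  apply: dotv_inj => w; rewrite !dotvDl !dotvZl -!bform_dotv -muE.
  by rewrite /mu bform_diag // (dotvC w) (dotvC w) addrC -addrA F2_addxx addr0.
move: xE; case: (F2P (mu v0)) => ->; case: (F2P (mu u0)) => ->;
  rewrite ?scale0r ?scale1r ?addr0 ?add0r ?addrA => xE.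
- by move: Gxx; rewrite bform_diag // -xE xx => /eqP.
- by rewrite !inE -xE eqxx !orbT.
- by rewrite !inE -xE eqxx.
- by rewrite !inE -xE eqxx !orbT.
Qed.

End Peeling.

Lemma symmetric_addmx k (A B : 'M[F2]_k) : A^T = A -> B^T = B -> (A + B)^T = A + B.
Proof. by move=> symA symB; rewrite linearD /= symA symB. Qed.

Lemma const1_dot k : dotv (const_mx 1 : 'rV[F2]_k) (const_mx 1) = k%:R.
Proof.
rewrite dotv_sum; under eq_bigr => i _ do rewrite !mxE mulr1.
by rewrite sumr_const card_ord.
Qed.

Lemma delta_row_inj k : injective (fun i : 'I_k => delta_mx 0 i : 'rV[F2]_k).
Proof. by move=> i j /rowP/(_ i); rewrite !mxE !eqxx /=; case: eqP => // _ /eqP. Qed.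

(** In dimension 3 counting guarantees only two candidates, too few to avoid both excluded vectors.
    Instead a unit vector is shown to work: otherwise each e_i with G_ii = 0 is the characteristic
    vector of H, so there is just one such index i0, and the other two indices p, q satisfy G_pq =
    0. Then row p of H vanishes, against invertibility. *)
Lemma peel_vector3 (G : 'M[F2]_3) u0 v0 :
    G^T = G -> 1%:M + G \in unitmx -> bform (alt_part G) u0 v0 = 1 ->
    (exists x, bform (1%:M + G) x x = 1) ->
  exists x, [/\ dotv x x = 1, bform G x x = 0, x <> const_mx 1
    & x *m (1%:M + G) <> diagv (1%:M + G)].
Proof.
move=> symG uH b1 [x0 Hx0]; set H := 1%:M + G in uH Hx0 *.
have symH : H^T = H by rewrite symmetric_addmx ?trmx1.
have GC i j : G i j = G j i by rewrite -[in LHS]symG mxE.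
have HE i j : H i j = (i == j)%:R + G i j by rewrite !mxE.
case: (pickP (fun i => (G i i == 0) && (row i H != diagv H))) => [i | none].
  case/andP=> /eqP Gii /eqP; rewrite rowE => neqi; exists (delta_mx 0 i).
  rewrite dotv_delta mxE !eqxx bform_delta; split=> //.
  move/rowP/(_ (i + 1)); rewrite !mxE eqxx /=.
  by case: i {Gii neqi} => [[|[|[|]]]].
have rowH i : G i i = 0 -> row i H = diagv H.
  by move=> Gii; apply/eqP; have := none i; rewrite Gii eqxx; case: eqP.
have [i0 Gi0] : exists i0, G i0 i0 = 0.
  case: (pickP (fun i => G i i == 0)) => [i /eqP Gii | G1]; first by exists i.
  suff H0 : diagv H = 0 by move: Hx0; rewrite bform_diag // H0 dotvC dot0v.
  apply/rowP => i; rewrite !mxE eqxx.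
  by case: (F2P (G i i)) (G1 i) => -> // _; apply/eqP.
have G1 i : i != i0 -> G i i = 1.
  case: (F2P (G i i)) => // Gii /eqP[]; apply: delta_row_inj.
  apply: (can_inj (mulmxK uH)); rewrite -!rowE !rowH //.
have Gi0j j : j != i0 -> G i0 j = 0.
  move=> neqj; have /rowP/(_ j) := rowH i0 Gi0; rewrite !mxE eq_sym (negPf neqj) eqxx G1 //.
  by rewrite add0r => ->; apply/eqP.
have altE p q : alt_part G p q = G p q + G p p * G q q by rewrite !mxE big_ord1 !mxE.
have [p [q pq]] : exists p q, alt_part G p q = 1.
  case: (pickP (fun pq => alt_part G pq.1 pq.2 == 1)) => [[p q] /eqP pq | B0].
    by exists p, q.
  suff B_0 : alt_part G = 0 by move: b1; rewrite /bform B_0 mulmx0 mul0mx mxE.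
  apply/matrixP => p q; rewrite [RHS]mxE.
  by case: (F2P (alt_part G p q)) (B0 (p, q)) => ->.
have pi0 : p != i0.
  apply/eqP => p_i0; move: pq; rewrite altE p_i0 Gi0 mul0r addr0.
  have [-> | /Gi0j -> //] := eqVneq q i0; by rewrite Gi0.
have qi0 : q != i0.
  by apply/eqP => q_i0; move: pq; rewrite altE q_i0 Gi0 mulr0 addr0 GC Gi0j.
have neqpq : p != q.
  by apply/eqP => p_q; move: pq; rewrite altE p_q F2_mulxx F2_addxx.
have Gpq : G p q = 0.
  by move: pq; rewrite altE !G1 //; case: (F2P (G p q)) => -> // /eqP.
suff /(unitmx_inj uH)/rowP/(_ p) : (delta_mx 0 p : 'rV_3) *m H = 0.
  by rewrite !mxE !eqxx.
apply/rowP => j; rewrite -rowE mxE HE [RHS]mxE.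
have [<- | neqj] := eqVneq p j; first by rewrite G1 //; apply/eqP.
have [-> | neqjq] := eqVneq j q; first by rewrite Gpq addr0.
have -> : j = i0.
  apply/val_inj; move: pi0 qi0 neqpq neqj neqjq; rewrite -!(inj_eq val_inj) /=.
  by case: p q i0 j {pq Gi0 G1 Gi0j Gpq} =>
    [[|[|[|?]]] ?] [[|[|[|?]]] ?] [[|[|[|?]]] ?] [[|[|[|?]]] ?].
by rewrite GC Gi0j ?addr0.
Qed.

(** The last two conclusions are the hypotheses needed on the reduced form, of size k. For odd k
    parity alone excludes the all-ones and characteristic vectors; for k = 2 the lemma in dimension
    3 applies; for larger k the excluded vectors, 3 for odd k and 5 for even k, are fewer than the
    2^(k - 1) available solutions. *)
Lemma peel_vector k (G : 'M[F2]_k.+1) :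
    G^T = G -> 1%:M + G \in unitmx -> (exists x, bform (1%:M + G) x x = 1) ->
    ((1 < k)%N -> exists u v, bform (alt_part G) u v = 1) ->
  exists x, [/\ dotv x x = 1, bform G x x = 0, k = 0%N \/ x <> const_mx 1,
    k = 0%N \/ (exists u, dotv u x = 0 /\ bform (1%:M + G) u u + bform G u x = 1)
    & (2 < k)%N -> exists u v, [/\ dotv u x = 0, dotv v x = 0 &
        bform G u v + bform G u x * bform G v x <>
        (bform G u u + bform G u x) * (bform G v v + bform G v x)]].
Proof.
move=> symG uH nonaltH altG; set H := 1%:M + G in uH nonaltH *.
have symH : H^T = H by rewrite symmetric_addmx ?trmx1.
have HE x : bform H x x = dotv x x + bform G x x by rewrite bform_addl -dotvE.
(* One of e, y, y + e works, where e is a unit vector and y is a witness that I + G is not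
   alternate. *)
have [x0 x0x0 Gx0] : exists2 x0, dotv x0 x0 = 1 & bform G x0 x0 = 0.
  case: nonaltH => y; rewrite HE; pose e : 'rV[F2]_k.+1 := delta_mx 0 0.
  have ee : dotv e e = 1 by rewrite dotv_delta mxE !eqxx.
  case: (F2P (bform G e e)) => Ge; first by exists e.
  case: (F2P (bform G y y)) => Gy; rewrite Gy.
    by rewrite addr0; exists y.
  case: (F2P (dotv y y)) => yy; last by rewrite yy F2_addxx => /esym/eqP; rewrite oner_eq0.
  by exists (y + e); rewrite ?dotvDD ?bformDD // ?yy ?ee ?Gy ?Ge ?add0r //; apply/eqP.
have exS L : (size L < 2 ^ (k.+1 - 2))%N ->
    exists x, [/\ dotv x x = 1, bform G x x = 0 & x \notin L].
  move=> ltL; have [x [xW xL]] :=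
    @solution_notin _ (1 + 1) (col_mx (const_mx 1) (diagv G))^T x0 L ltL.
  exists x; move: xW; rewrite tr_col_mx !mul_mx_row => /eq_row_mx[x1 x2].
  split=> //; first by rewrite dotv_diag /dotv x1 -/(dotv x0 _) -dotv_diag.
  by rewrite bform_diag // /dotv x2 -/(dotv x0 _) -bform_diag.
pose h := diagv H *m invmx H.
have xH_h x : x != h -> x *m H <> diagv H.
  by move=> /eqP neqx xH; case: neqx; rewrite /h -xH mulmxK.
(* The size k + 1 is even, so 1.1 = 0; and by [bform_inv_diag] the characteristic vector h of H
   satisfies H(h, h) = 0, whereas H(x, x) = 1. *)
have even_ok x : odd k -> dotv x x = 1 -> bform G x x = 0 ->
    x <> const_mx 1 /\ x *m H <> diagv H.
  move=> odd_k xx Gxx; split=> [x1 | xH].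
    by move: xx; rewrite x1 const1_dot F2_natr /= odd_k.
  have := bform_inv_diag symH uH; rewrite -{1}xH bform_dotv mulmxK // -xH.
  by rewrite dotvC -bform_dotv HE xx Gxx F2_natr /= odd_k => /esym/eqP.
have [k0 | k_gt0] := posnP k.
  by exists x0; split=> //; [left | left | move=> k3; rewrite k0 in k3].
have peel x : dotv x x = 1 -> bform G x x = 0 -> x <> const_mx 1 -> x *m H <> diagv H ->
    ((2 < k)%N -> exists u v, [/\ dotv u x = 0, dotv v x = 0 &
        bform G u v + bform G u x * bform G v x <>
        (bform G u u + bform G u x) * (bform G v v + bform G v x)]) ->
    exists x, [/\ dotv x x = 1, bform G x x = 0, k = 0%N \/ x <> const_mx 1,
    k = 0%N \/ (exists u, dotv u x = 0 /\ bform H u u + bform G u x = 1)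
    & (2 < k)%N -> exists u v, [/\ dotv u x = 0, dotv v x = 0 &
        bform G u v + bform G u x * bform G v x <>
        (bform G u u + bform G u x) * (bform G v v + bform G v x)]].
  move=> xx Gxx x1 xH peel_alt; exists x; split=> //; right=> //.
  exact: nonalternate_peel xx Gxx xH.
have /orP[k_le2 | k_gt2] : (k <= 2)%N || (2 < k)%N by rewrite leqNgt orNb.
  have [odd_k | even_k] := boolP (odd k).
    have [x1 xH] := even_ok _ odd_k x0x0 Gx0.
    by apply: (peel x0 x0x0 Gx0 x1 xH) => k3; rewrite leqNgt k3 in k_le2.
  have k2 : k = 2%N by case: (k) k_gt0 k_le2 even_k => [|[|[|]]].
  have [u0 [v0 uv]] : exists u v, bform (alt_part G) u v = 1 by apply: altG; rewrite k2.
  have [x [xx Gxx x1 xH]] : exists x, [/\ dotv x x = 1, bform G x x = 0, x <> const_mx 1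
      & x *m (1%:M + G) <> diagv (1%:M + G)].
    clear -symG uH nonaltH uv k2; move: uH nonaltH; rewrite /H; clear H.
    move: G u0 v0 symG uv; rewrite k2 => G u0 v0 symG uv uH nonaltH.
    exact: peel_vector3 uv nonaltH.
  by apply: (peel x) => // k3; rewrite k2 in k3.
have [u0 [v0 uv]] := altG (ltnW k_gt2).
pose bad := [:: diagv G + u0 *m alt_part G; diagv G + v0 *m alt_part G;
  diagv G + u0 *m alt_part G + v0 *m alt_part G].
have [odd_k | even_k] := boolP (odd k).
  have [|x [xx Gxx xL]] := exS bad.
    by rewrite (@leq_trans (2 ^ 2)) // leq_exp2l // leq_subRL // ltnW.
  have [x1 xH] := even_ok _ odd_k xx Gxx; apply: (peel x) => // _.
  exact: alt_part_peel xx Gxx uv xL.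
have k_gt3 : (3 < k)%N by rewrite ltn_neqAle k_gt2 andbT; apply: contraNneq even_k => <-.
have [|x [xx Gxx]] := exS [:: const_mx 1, h & bad].
  by rewrite (@leq_trans (2 ^ 3)) // leq_exp2l // leq_subRL // ltnW.
rewrite 2!in_cons 2!negb_or => /and3P[/eqP x1 /xH_h xH xL].
apply: (peel x xx Gxx x1 xH) => _; exact: alt_part_peel xx Gxx uv xL.
Qed.

(** * Walks in the graph *)

Lemma vsq_sym n (z : 'rV[F2]_n) : (vsq z)^T = vsq z.
Proof. by rewrite trmx_mul trmxK. Qed.

Lemma mul_vsq n (v z : 'rV[F2]_n) : v *m vsq z = dotv v z *: z.
Proof. by rewrite mulmxA mul_dotv. Qed.

Lemma rank_vsq n (z : 'rV[F2]_n) : z != 0 -> \rank (vsq z) = 1%N.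
Proof.
move=> nz; apply/eqP; rewrite eqn_leq (leq_trans (mxrankM_maxr _ _) (rank_leq_row _)).
rewrite lt0n mxrank_eq0; apply: contraNneq nz => z0; apply/eqP/rowP => i.
by move/matrixP/(_ i i): z0; rewrite !mxE big_ord1 mxE F2_mulxx.
Qed.

Lemma rank1_sym n (D : 'M[F2]_n) : D^T = D -> \rank D = 1%N -> exists z, D = vsq z.
Proof.
move=> symD rkD; have: exists c : 'M[F2]_(n, \rank D), exists r : 'M_(\rank D, n), D = c *m r.
  by exists (col_base D), (row_base D); rewrite mulmx_base.
rewrite rkD => -[c [r Dcr]]; have DE a b : D a b = c a 0 * r 0 b.
  by rewrite Dcr mxE big_ord1.
have DC a b : c a 0 * r 0 b = c b 0 * r 0 a by rewrite -!DE -[in LHS]symD mxE.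
have [i [j Dij]] : exists i j, D i j = 1.
  case: (pickP (fun p => D p.1 p.2 == 1)) => [[i j] /eqP Dij | D0]; first by exists i, j.
  suff D_0 : D = 0 by move: rkD; rewrite D_0 mxrank0.
  apply/matrixP => i j; rewrite [RHS]mxE.
  by case: (F2P (D i j)) (D0 (i, j)) => ->.
exists r; rewrite Dcr; congr (_ *m _); apply/colP => a; rewrite mxE.
move: Dij (DC i j) (DC a i); rewrite DE.
move: (c i 0) (c j 0) (r 0 i) (r 0 j) (c a 0) (r 0 a) => {DE DC D c r symD rkD Dcr i j a}.
move=> ci cj ri rj ca ra; f2.
Qed.

Lemma walk_rcons n k (A B C : 'M[F2]_n) :
  walk k A B -> sgl C -> \rank (B - C) = 1%N -> walk k.+1 A C.
Proof.
elim: k A => [|k IHk] A /= => [-> sC rkC | [A' [sA' [rkA' wA']]] sC rkC].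
  by exists C.
by exists A'; split=> //; split=> //; apply: IHk.
Qed.

(** Sherman-Morrison: the denominator 1 + z M^-1 z^T equals 1 here. *)
Lemma sgl_addsq n (M : 'M[F2]_n) z : sgl M -> dotv z (z *m invmx M) = 0 ->
  sgl (M + vsq z) /\
  invmx (M + vsq z) = invmx M + (z *m invmx M)^T *m (z *m invmx M).
Proof.
case/andP=> /eqP symM uM zz; pose w := z *m invmx M.
have MV : (M + vsq z) *m (invmx M + w^T *m w) = 1%:M.
  have Mw : M *m w^T = z^T by rewrite trmx_mul trmx_invmx // mulmxA mulmxV // mul1mx.
  rewrite mulmxDl !mulmxDr mulmxV // mulmxA Mw -mulmxA -/w.
  rewrite -[z^T *m z *m _]mulmxA (mulmxA z) mul_dotv zz scale0r mulmx0 addr0.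
  by rewrite -addrA mx_addxx addr0.
have [uMz _] := mulmx1_unit MV; split.
  by rewrite /sgl uMz symmetric_addmx ?vsq_sym ?eqxx.
by rewrite -[LHS]mulmx1 -MV (mulmxA (invmx (M + vsq z))) mulVmx // mul1mx.
Qed.

(** One direction of Sylvester's identity det(M + T^T T) = det(M) det(I + T M^-1 T^T), argued on
    kernels. *)
Lemma gram_unit n k (M : 'M[F2]_n) (T : 'M[F2]_(k, n)) :
  M \in unitmx -> M + T^T *m T \in unitmx -> 1%:M + T *m invmx M *m T^T \in unitmx.
Proof.
move=> uM uA; apply: unitmx_ker => c; rewrite mulmxDr mulmx1 => c0.
have v0 : c *m T *m invmx M = 0.
  apply: unitmx_inj uA _; rewrite mulmxDr mulmxKV // mulmxA -mulmxDl.
  by move: c0; rewrite !mulmxA => ->; rewrite mul0mx.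
by move: c0; rewrite !mulmxA v0 mul0mx addr0.
Qed.

(** Induction on the rows of [T]. With x from [peel_vector] and z = xT, the edge from M + z^2 to M
    is appended at the end of the walk. Relative to M + z^2, the remaining rows QT have as Gram form
    the reduced form of [peel_vector], by Sherman-Morrison ([G1E]). *)
Lemma short_walk k n (M : 'M[F2]_n) (T : 'M[F2]_(k, n)) (G := T *m invmx M *m T^T) :
    sgl M -> M + T^T *m T \in unitmx ->
    k = 0%N \/ (exists x, bform (1%:M + G) x x = 1) ->
    ((2 < k)%N -> exists u v, bform (alt_part G) u v = 1) ->
  exists2 j, (j <= k)%N & walk j (M + T^T *m T) M.
Proof.
elim: k M T @G => [|k IHk] M T G sM uA nonalt alt.
  exists 0%N => //=; suff -> : T^T *m T = 0 by rewrite addr0.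
  by apply/matrixP => i j; rewrite !mxE big_ord0.
case: nonalt => // nonalt; have /andP[/eqP symM uM] := sM.
have symV := trmx_invmx symM.
have symG : G^T = G by rewrite trmx_congruence.
have [x [xx Gxx x_k alt1 alt2]] := peel_vector symG (gram_unit uM uA) nonalt alt.
have [Q [QQ Qx xQ]] := orthonormal_completion xx x_k.
pose z := x *m T; pose T1 := Q *m T; pose w := z *m invmx M.
have zz : dotv z (z *m invmx M) = 0.
  by rewrite dotvC -bform_dotv -bform_mx.
have [sM1 M1V] := sgl_addsq sM zz; rewrite -/w in M1V.
have AE : M + T^T *m T = M + vsq z + T1^T *m T1.
  rewrite -addrA; congr (_ + _); rewrite /vsq !trmx_mul !mulmxA -mulmxDl.
  by rewrite -(mulmxA _ x^T) -(mulmxA _ Q^T) -mulmxDr xQ mulmx1.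
have G1E a b : bform (T1 *m invmx (M + vsq z) *m T1^T) a b =
    bform G (a *m Q) (b *m Q) + bform G (a *m Q) x * bform G (b *m Q) x.
  rewrite bform_mx M1V bform_addl bform_col_sq.
  have wE u : dotv (u *m T) w = bform G u x.
    by rewrite dotvC -bform_dotv -bform_mx bformC.
  by rewrite /T1 !mulmxA !wE -(bform_mx T).
have symG1 : (T1 *m invmx (M + vsq z) *m T1^T)^T = T1 *m invmx (M + vsq z) *m T1^T.
  by have /andP[/eqP symM1 _] := sM1; rewrite trmx_congruence ?trmx_invmx.
have span u : dotv u x = 0 -> u = u *m Q^T *m Q.
  by move=> ux; rewrite -[LHS]mulmx1 -xQ mulmxDr !mulmxA mul_dotv ux scale0r add0r.
have [|||j le_jk wj] := IHk (M + vsq z) T1 sM1.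
- by rewrite -AE.
- case: alt1 => [k0 | [u [ux Hu]]]; [by left | right; exists (u *m Q^T)].
  rewrite bform_addl -dotvE G1E -!span // F2_mulxx addrA -Hu bform_addl -dotvE.
  by rewrite {1}/dotv trmx_mul trmxK mulmxA -span.
- move=> k_gt2; have [u [v [ux vx neq]]] := alt2 k_gt2.
  exists (u *m Q^T), (v *m Q^T); rewrite bform_alt // !G1E -!span // !F2_mulxx.
  exact: F2_neq_add.
(* A zero vector gives no edge, which is why the walk is only claimed to have length at most k. *)
have [z0 | nz] := eqVneq z 0.
  exists j; first exact: leq_trans le_jk _.
  by rewrite AE; move: wj; rewrite z0 /vsq mulmx0 addr0.
exists j.+1 => //; rewrite AE; apply: walk_rcons wj sM _.
by rewrite addrC addKr rank_vsq.
Qed.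

(** * Walks as sequences of squares *)

Definition vsum n (s : seq 'rV[F2]_n) : 'M[F2]_n := \sum_(z <- s) vsq z.

(** Removing squares from the head of s leads from I + [vsum s] to I, so the matrices visited are
    given by suffixes. Zero vectors are allowed and stand for no move. *)
Fixpoint unit_suffixes n (s : seq 'rV[F2]_n) : bool :=
  (1%:M + vsum s \in unitmx) && (if s is _ :: t then unit_suffixes t else true).

Lemma vsum_cons n z (s : seq 'rV[F2]_n) : vsum (z :: s) = vsq z + vsum s.
Proof. by rewrite /vsum big_cons. Qed.

Lemma vsum_sym n (s : seq 'rV[F2]_n) : (vsum s)^T = vsum s.
Proof. by rewrite /vsum linear_sum /=; apply: eq_bigr => z _; rewrite vsq_sym. Qed.

Lemma sgl_vsum n (s : seq 'rV[F2]_n) : sgl (1%:M + vsum s) = (1%:M + vsum s \in unitmx).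
Proof. by rewrite /sgl symmetric_addmx ?trmx1 ?vsum_sym ?eqxx. Qed.

Lemma unit_suffixes_unit n (s : seq 'rV[F2]_n) :
  unit_suffixes s -> 1%:M + vsum s \in unitmx.
Proof. by case: s => [|z s] /= /andP[]. Qed.

Lemma walk_vsum n k (A : 'M[F2]_n) : sgl A -> walk k A 1%:M ->
  exists s, [/\ size s = k, A = 1%:M + vsum s & unit_suffixes s].
Proof.
elim: k A => [|k IHk] A sA /=.
  by move->; exists [::]; rewrite /= /vsum big_nil addr0 unitmx1.
case=> C [sC [rkC /(IHk _ sC)[s [<- CE us]]]].
have [/andP[/eqP symA uA] /andP[/eqP symC _]] := (sA, sC).
have [|z zE] := rank1_sym _ rkC; first by rewrite linearB /= symA symC.
have AE : A = 1%:M + vsum (z :: s).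
  by rewrite vsum_cons addrCA -CE -zE subrK.
by exists (z :: s); split=> //=; rewrite -AE uA.
Qed.

Lemma vsum_walk n (s : seq 'rV[F2]_n) : unit_suffixes s ->
  exists2 j, (j <= size s)%N & walk j (1%:M + vsum s) 1%:M.
Proof.
elim: s => [|z s IHs] /=; first by exists 0%N => //=; rewrite /vsum big_nil addr0.
case/andP=> uA /[dup] us /IHs[j le_js wj]; rewrite vsum_cons addrCA.
have [-> | nz] := eqVneq z 0.
  by exists j; [exact: leqW | rewrite /vsq mulmx0 add0r].
exists j.+1 => //; exists (1%:M + vsum s); split; last split=> //.
  by rewrite sgl_vsum unit_suffixes_unit.
by rewrite addrK rank_vsq.
Qed.

(** The invertibility criteria below depend only on inner products between entries and so hold for
    any list drawn from r; this spares an induction over its suffixes. *)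
Lemma unit_suffixes_cat n (r s : seq 'rV[F2]_n) : unit_suffixes s ->
  (forall t, {subset t <= r} -> 1%:M + vsum (t ++ s) \in unitmx) -> unit_suffixes (r ++ s).
Proof.
move=> us; elim: r => //= z r IHr ur; rewrite (ur (z :: r)) //=.
by apply: IHr => t tr; apply: ur => y /tr yr; rewrite inE yr orbT.
Qed.

Lemma mul_vsum n (v : 'rV[F2]_n) s : v *m vsum s = \sum_(z <- s) dotv v z *: z.
Proof. by rewrite mulmx_sumr; apply: eq_bigr => z _; rewrite mul_vsq. Qed.

(** A kernel vector satisfies v = sum (v.z) z, so invertibility becomes a computation with the inner
    products v.z alone. *)
Lemma vsum_unit n (s : seq 'rV[F2]_n) :
    (forall v, (forall w, dotv v w = \sum_(z <- s) dotv v z * dotv z w) ->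
      forall z, z \in s -> dotv v z = 0) ->
  1%:M + vsum s \in unitmx.
Proof.
move=> ker0; apply: unitmx_ker => v; rewrite mulmxDr mulmx1 mul_vsum => /mx_add_eq0 vE.
rewrite vE big1_seq // => z /= zs; rewrite ker0 ?scale0r // => w.
by rewrite [in LHS]vE dotv_suml; apply: eq_bigr => y _; rewrite dotvZl.
Qed.

(** * Flat families and the lower bound on the distance *)

Definition flat n (S : {pred 'rV[F2]_n}) : Prop :=
  {in S &, forall u v, dotv u v = dotv u u * dotv v v}.

(** For a kernel vector v, flatness gives v.z = a (z.z) with a = sum (v.z)(z.z); substituting back,
    a is a multiple of sum z.z = 0. *)
Lemma flat_unit n (s : seq 'rV[F2]_n) : flat (mem s) ->
  \sum_(z <- s) dotv z z = 0 -> 1%:M + vsum s \in unitmx.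
Proof.
move=> flat_s sum0; apply: vsum_unit => v vE.
pose a := \sum_(z <- s) dotv v z * dotv z z.
have vz z : z \in s -> dotv v z = a * dotv z z.
  move=> zs; rewrite vE /a big_distrl /=; apply: eq_big_seq => y ys.
  by rewrite (flat_s y z) // mulrA.
suff a0 : a = 0 by move=> z /vz ->; rewrite a0 mul0r.
transitivity (a * \sum_(z <- s) dotv z z); last by rewrite sum0 mulr0.
by rewrite big_distrr /=; apply: eq_big_seq => z /vz ->; rewrite -mulrA F2_mulxx.
Qed.

(* The first vector z (from the right) with z.z = 1 is orthogonal to its
   predecessors, hence lies in the kernel of I + vsum (z :: t). *)
Lemma flat_unit_suffixes n (s : seq 'rV[F2]_n) : flat (mem s) -> unit_suffixes s ->
  forall z, z \in s -> dotv z z = 0.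
Proof.
elim: s => //= y s IHs flat_s /andP[uy us].
have {}IHs z : z \in s -> dotv z z = 0.
  by apply: IHs us _ => u v us vs; apply: flat_s; rewrite inE ?us ?vs orbT.
move=> z; rewrite inE => /orP[/eqP -> | /IHs //].
case: (F2P (dotv y y)) => // yy; suff y0 : y = 0 by move: yy; rewrite y0 dot0v.
apply: unitmx_inj uy _; rewrite vsum_cons mulmxDr mulmx1 mulmxDr mul_vsq yy scale1r mx_addK.
rewrite mul_vsum big1_seq // => w /= ws.
by rewrite (flat_s y w) ?inE ?eqxx ?ws ?orbT //= (IHs w) // mulr0 scale0r.
Qed.

Lemma trmx_mul_rows m n (Z : 'M[F2]_(m, n)) : Z^T *m Z = \sum_(i < m) vsq (row i Z).
Proof.
apply/matrixP => a b; rewrite summxE !mxE; apply: eq_bigr => i _.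
by rewrite !mxE big_ord1 !mxE.
Qed.

Lemma flat_walk_long n (s : seq 'rV[F2]_n) (D := vsum s) :
    flat [pred u | (u <= D)%MS] -> (exists u : 'rV_n, (u <= D)%MS /\ dotv u u = 1) ->
  unit_suffixes s -> (\rank D + 2 <= size s)%N.
Proof.
move=> flatD [u [uD uu]] us; rewrite leqNgt; apply/negP; rewrite addn2 ltnS => le_s.
pose Z : 'M[F2]_(size s, n) := \matrix_(i < size s) nth 0 s i.
have DZ : D = Z^T *m Z.
  rewrite trmx_mul_rows /D /vsum (big_nth 0) big_mkord.
  by apply: eq_bigr => i _; rewrite rowK.
have sZ z : z \in s -> (z <= Z)%MS.
  move=> zs; have lt_z : (index z s < size s)%N by rewrite index_mem.
  have -> : z = row (Ordinal lt_z) Z by rewrite rowK /= nth_index.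
  exact: row_sub.
have leDZ : (D <= Z)%MS by rewrite DZ submxMl.
(* If the entries of s spanned more than D, then, there being at most rank D + 1 of them, they would
   be independent, and D = Z^T Z would have the rank of Z. *)
have ZD : (Z <= D)%MS.
  have [_ <-] := mxrank_leqif_sup leDZ; rewrite eqn_leq mxrankS // leqNgt.
  apply/negP => ltDZ; have freeZ : row_free Z.
    by rewrite /row_free eqn_leq rank_leq_row (leq_trans le_s).
  by move: ltDZ; rewrite {1}DZ mxrankMfree // mxrank_tr ltnn.
have s0 : forall z, z \in s -> dotv z z = 0.
  apply: flat_unit_suffixes us => y z ys zs.
  by apply: flatD; rewrite inE (submx_trans _ ZD) ?sZ.
have /submxP[c uE] := submx_trans uD leDZ.
suff: dotv u u = 0 by rewrite uu => /eqP.
rewrite dotv_diag uE mulmx_sum_row dotv_suml big1 // => i _.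
by rewrite dotvZl -dotv_diag s0 ?mulr0 // rowK mem_nth.
Qed.

(** * Explicit walks for flat families *)

Section OddFamily.

Variables (n : nat) (x y : 'rV[F2]_n).
Hypotheses (xx : dotv x x = 0) (xy : dotv x y = 1) (yy : dotv y y = 1).

Lemma vsum1_unit : 1%:M + vsum [:: x] \in unitmx.
Proof.
apply: vsum_unit => v vE z; rewrite inE => /eqP ->.
by rewrite vE big_seq1 xx mulr0.
Qed.

(** Pairing a kernel vector v with x gives v.x = v.y, and on r it gives v.z = (a + v.y)(z.z);
    pairing with y then gives v.y = a, so everything vanishes. *)
Lemma vsum_cat2_unit (r : seq 'rV[F2]_n) :
    (forall z, z \in r -> dotv x z = 0 /\ dotv y z = dotv z z) -> flat (mem r) ->
  1%:M + vsum (r ++ [:: y; x]) \in unitmx.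
Proof.
move=> r_xy flat_r; apply: vsum_unit => v vE.
pose a := \sum_(z <- r) dotv v z * dotv z z.
have expand w : dotv v w =
    \sum_(z <- r) dotv v z * dotv z w + (dotv v y * dotv y w + dotv v x * dotv x w).
  by rewrite {1}vE big_cat /= big_cons big_seq1.
have vx : dotv v x = dotv v y.
  rewrite expand xx mulr0 addr0 (dotvC y) xy mulr1 big1_seq ?add0r // => z /= /r_xy[xz _].
  by rewrite (dotvC z) xz mulr0.
have vz z : z \in r -> dotv v z = (a + dotv v y) * dotv z z.
  move=> zr; have [xz yz] := r_xy z zr; rewrite expand xz mulr0 addr0 yz mulrDl.
  congr (_ + _); rewrite /a big_distrl /=; apply: eq_big_seq => w wr.
  by rewrite (flat_r w z) // mulrA.
have a0 : a + dotv v y = 0.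
  move: (expand y); rewrite yy xy !mulr1 vx F2_addxx addr0 => ->.
  rewrite -[RHS](F2_addxx a); congr (_ + _); apply: eq_big_seq => z /r_xy[_ yz].
  by rewrite -yz (dotvC z).
have vr0 z : z \in r -> dotv v z = 0 by move/vz ->; rewrite a0 mul0r.
have vy : dotv v y = 0.
  by rewrite -[LHS]add0r -{1}a0 -addrA F2_addxx addr0 /a big1_seq // => z /= /vr0 ->; rewrite mul0r.
by move=> z; rewrite mem_cat !inE => /or3P[/vr0 | /eqP -> | /eqP ->] //; rewrite vx.
Qed.

End OddFamily.

Lemma totally_isotropic_unit n (r : seq 'rV[F2]_n) :
  {in r &, forall u v, dotv u v = 0} -> 1%:M + vsum r \in unitmx.
Proof.
move=> r0; apply: vsum_unit => v vE z zr; rewrite vE big1_seq // => w /= wr.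
by rewrite (r0 w z) // mulr0.
Qed.

Section EvenFamily.

Variables (n : nat) (p q : 'rV[F2]_n) (r : seq 'rV[F2]_n).
Hypotheses (odd_r : odd (size r)) (r0 : {in r &, forall u v, dotv u v = 0}).
Hypotheses (pp : dotv p p = 1) (pr : {in r, forall z, dotv p z = 1}).

Lemma vsum_odd_isotropic_unit : 1%:M + vsum (p :: r) \in unitmx.
Proof.
apply: vsum_unit => v vE.
have expand w : dotv v w = dotv v p * dotv p w + \sum_(z <- r) dotv v z * dotv z w.
  by rewrite {1}vE big_cons.
have vr z : z \in r -> dotv v z = dotv v p.
  move=> zr; rewrite expand pr // mulr1 big1_seq ?addr0 // => w /= wr.
  by rewrite (@r0 w z) // mulr0.
have vp : dotv v p = 0.
  have := expand p; rewrite pp mulr1 -{1}[dotv v p]addr0 => /addrI.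
  rewrite (eq_big_seq (fun=> dotv v p)); last by move=> z zr; rewrite (dotvC z) pr ?mulr1 ?vr.
  by rewrite big_const_seq count_predT iter_addr_0 -mulr_natr F2_natr odd_r mulr1.
by move=> z; rewrite inE => /orP[/eqP -> // | /vr ->].
Qed.

Hypotheses (qq : dotv q q = 0) (pq : dotv p q = 0) (qr : {in r, forall z, dotv q z = 1}).

(** The inner products assumed here are those of the shifted vectors w + t_h in [even_family_walk]:
    t holds those with t_h odd, q and p the two special ones, r the remaining even ones together
    with w. *)
Lemma vsum_even_family_unit (t : seq 'rV[F2]_n) :
    {in t & r, forall u v, dotv u v = 0} -> {in t &, forall u v, dotv u v = 1} ->
    {in t, forall u, dotv u p = 0 /\ dotv u q = 1} ->
  1%:M + vsum (t ++ [:: q, p & r]) \in unitmx.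
Proof.
move=> tr tt t_pq; apply: vsum_unit => v vE.
pose E := \sum_(z <- r) dotv v z; pose F := \sum_(z <- t) dotv v z.
have expand w : dotv v w = \sum_(z <- t) dotv v z * dotv z w +
    (dotv v q * dotv q w + (dotv v p * dotv p w + \sum_(z <- r) dotv v z * dotv z w)).
  by rewrite {1}vE big_cat /= !big_cons.
have vr z : z \in r -> dotv v z = dotv v q + dotv v p.
  move=> zr; rewrite expand pr // qr // !mulr1 !big1_seq ?addr0 ?add0r // => w /= wr.
    by rewrite (@r0 w z) // mulr0.
  by rewrite (tr w z) // mulr0.
have E0 : E = 0.
  have := expand p; rewrite pp mulr1 (dotvC q) pq mulr0 add0r big1_seq ?add0r; last first.
    by move=> w /= /t_pq[wp _]; rewrite wp mulr0.
  rewrite -{1}[dotv v p]addr0 => /addrI ->; apply: eq_big_seq => z zr.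
  by rewrite (dotvC z) pr ?mulr1.
have vq : dotv v q = F.
  have EE : \sum_(z <- r) dotv v z * dotv z q = 0.
    by rewrite -[RHS]E0 /E; apply: eq_big_seq => z zr; rewrite (dotvC z) qr ?mulr1.
  rewrite expand qq pq !mulr0 !add0r EE addr0 /F.
  by apply: eq_big_seq => z /t_pq[_ ->]; rewrite mulr1.
have vt z : z \in t -> dotv v z = 0.
  move=> zt; have [zp zq] := t_pq z zt.
  rewrite expand (dotvC q) zq mulr1 (dotvC p) zp mulr0 add0r [X in _ + (_ + X)]big1_seq; last first.
    by move=> w /= wr; rewrite (dotvC w) (tr z w) ?mulr0.
  rewrite addr0 vq [X in X + _](_ : _ = F) ?F2_addxx //.
  by rewrite /F; apply: eq_big_seq => w wt; rewrite (tt w z) ?mulr1.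
have {}vq : dotv v q = 0 by rewrite vq /F big1_seq // => z /= /vt.
have vp : dotv v p = 0.
  rewrite -E0 /E (eq_big_seq (fun=> dotv v p)); last by move=> z zr; rewrite vr // vq add0r.
  by rewrite big_const_seq count_predT iter_addr_0 -mulr_natr F2_natr odd_r mulr1.
move=> z; rewrite mem_cat !inE => /or4P[/vt | /eqP -> | /eqP -> | /vr ->] //.
by rewrite vq vp addr0.
Qed.

End EvenFamily.

Lemma F2_sum1 (I : finType) (f : I -> F2) : \sum_i f i = 1 -> exists i, f i = 1.
Proof.
move=> sum1; case: (pickP (fun i => f i == 1)) => [i /eqP fi | f0]; first by exists i.
move: sum1; rewrite big1 => [/eqP // | i _].
by case: (F2P (f i)) (f0 i) => ->.
Qed.

Section Walks.

Variables (p n : nat) (t : 'I_p -> 'rV[F2]_n) (c : 'I_p -> F2).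
Hypotheses (odd_n : odd n).
Hypotheses (flat_t : forall i j, dotv (t i) (t j) = dotv (t i) (t i) * dotv (t j) (t j)).
Hypotheses (ones_t : const_mx 1 = \sum_i c i *: t i).

Let l i := dotv (t i) (t i).

Let sum_cl : \sum_i c i * l i = 1.
Proof.
transitivity (dotv (const_mx 1) (const_mx 1 : 'rV[F2]_n)); last first.
  by rewrite const1_dot F2_natr odd_n.
rewrite [in RHS]ones_t dotv_suml; apply: eq_bigr => i _.
by rewrite dotvZl /l dotv_diag ones_t.
Qed.

Let dot_ones x : dotv x x = \sum_i c i * dotv (t i) x.
Proof.
by rewrite dotv_diag ones_t dotvC dotv_suml; apply: eq_bigr => i _; rewrite dotvZl.
Qed.

(** The sum of (1 + a + c_i) l_i is 1, and a nonzero term has l_i = 1 and c_i = a. *)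
Let exists_cl a : \sum_i l i = 0 -> exists i, l i = 1 /\ c i = a.
Proof.
move=> sum_l; have [|i i1] := @F2_sum1 _ (fun i => (1 + a + c i) * l i).
  under eq_bigr => i _ do rewrite mulrDl.
  by rewrite big_split /= sum_cl -big_distrr /= sum_l mulr0 add0r.
by exists i; move: i1; case: (F2P (l i)) => ->; case: (F2P (c i)) => ->;
  case: (F2P a) => -> /eqP.
Qed.

(** An auxiliary x is placed at both ends of the list, so its square cancels at the cost of two
    steps. It is dual to an odd t_i, and choosing c_i = 0 makes x.x = 0. *)
Lemma odd_family_walk :
    (forall i, exists x, forall h, dotv (t h) x = (h == i)%:R) -> \sum_i l i = 0 ->
  exists s, [/\ size s = p.+2, vsum s = \sum_i vsq (t i) & unit_suffixes s].
Proof.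
move=> dual_t sum_l; have [i [li ci]] := exists_cl 0 sum_l.
have [x tx] := dual_t i.
have xx : dotv x x = 0.
  rewrite dot_ones (bigD1 i) //= ci mul0r add0r big1 // => h neqh.
  by rewrite tx (negPf neqh) mulr0.
have xy : dotv x (t i) = 1 by rewrite dotvC tx eqxx.
pose r := [seq t h | h <- enum (predC1 i)].
have rP z : z \in r -> exists2 h, h != i & z = t h.
  by case/mapP=> h; rewrite mem_enum => hi ->; exists h.
have sumE : \sum_(z <- r) vsq z + vsq (t i) = \sum_j vsq (t j).
  by rewrite big_map big_enum /= [RHS](bigD1 i) //= addrC.
have sE : vsum (x :: r ++ [:: t i; x]) = \sum_j vsq (t j).
  rewrite vsum_cons /vsum big_cat /= big_cons big_seq1 [X in _ + X]addrA sumE.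
  by rewrite addrCA mx_addxx addr0.
exists (x :: r ++ [:: t i; x]); split=> //.
  rewrite /= size_cat size_map -cardE cardC1 card_ord /= addn2.
  by case: p i {li ci tx xx xy r rP sumE sE} => [[]|].
apply/andP; split.
  rewrite sE -(big_map t predT (@vsq n)); apply: flat_unit; last by rewrite big_map.
  by move=> u v /mapP[j _ ->] /mapP[h _ ->].
apply: unit_suffixes_cat => [|r' r'r].
  rewrite /= vsum1_unit // /vsum big_nil addr0 unitmx1 !andbT.
  exact: (@vsum_cat2_unit _ x (t i) xx xy li [::]).
apply: vsum_cat2_unit => // [z /r'r/rP[h neqh ->]|u v /r'r/rP[h _ ->] /r'r/rP[j _ ->]] //.
by rewrite dotvC tx (negPf neqh) flat_t -/(l i) li mul1r.
Qed.

(** Each t_h is replaced by w + t_h and w itself is added: cross terms vanish because the t_h sum to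
    0, and w^2 occurs p + 1 times, an even number. The vector w detects t_i odd and t_j even with
    c_i = c_j, so that w.w = c_i + c_j = 0. *)
Lemma even_family_walk : odd p -> \sum_i t i = 0 ->
    (forall i j, i != j -> exists w, forall h, dotv (t h) w = ((h == i) || (h == j))%:R) ->
  exists s, [/\ size s = p.+1, vsum s = \sum_i vsq (t i) & unit_suffixes s].
Proof.
move=> odd_p sum_t dual_t.
have sum_l : \sum_i l i = 0.
  under eq_bigr => i _ do rewrite /l dotv_diag.
  by rewrite -dotv_suml sum_t dot0v.
have [j lj] : exists j, l j = 0.
  have [|j lj] := @F2_sum1 _ (fun j => 1 + l j).
    by rewrite big_split /= sum_l addr0 sumr_const card_ord F2_natr odd_p.
  by exists j; move: lj; case: (F2P (l j)) => -> // /eqP.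
have [i [li ci]] := exists_cl (c j) sum_l.
have neqij : i != j by apply: contra_eq_neq li => ->; rewrite lj.
have [w tw] := dual_t i j neqij.
have ww : dotv w w = 0.
  rewrite dot_ones (bigD1 i) //= (bigD1 j) 1?eq_sym //= !tw !eqxx orbT ci !mulr1 addrA F2_addxx.
  by rewrite add0r big1 // => h /andP[/negPf hi /negPf hj]; rewrite tw hi hj mulr0.
have dotE g h : dotv (w + t g) (w + t h) = l g * l h + dotv (t g) w + dotv (t h) w.
  rewrite dotvDl !dotvDr ww add0r flat_t (dotvC w) [RHS]addrC.
  by congr (_ + _); apply: addrC.
have dotw h : dotv w (w + t h) = dotv (t h) w by rewrite dotvDr ww add0r dotvC.
pose ones := enum [pred h | (l h == 1) && (h != i)].
pose zeros := enum [pred h | (l h == 0) && (h != j)].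
pose z h := w + t h.
pose s := [seq z h | h <- ones] ++ [:: z j, z i & rcons [seq z h | h <- zeros] w].
have perm_o : perm_eq (ones ++ [:: j, i & zeros]) (enum 'I_p).
  apply: uniq_perm; last 1 first.
  - move=> h; rewrite mem_cat !inE !mem_enum !inE.
    have [-> | hj] := eqVneq h j; first by rewrite orbT.
    have [-> | hi] := eqVneq h i; first by rewrite orbT.
    by case: (F2P (l h)) => ->.
  - rewrite cat_uniq enum_uniq /= enum_uniq !inE !mem_enum !inE !eqxx lj li andbF.
    rewrite [j == i]eq_sym (negPf neqij) /= !andbT -all_predC; apply/allP => h.
    by rewrite mem_enum inE => /andP[/eqP lh _]; rewrite /= mem_enum inE lh.
  - exact: enum_uniq.
have perm_s : perm_eq s (w :: [seq z h | h <- enum 'I_p]).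
  have -> : s = rcons [seq z h | h <- ones ++ [:: j, i & zeros]] w.
    by rewrite map_cat -cats1 -catA /= cats1.
  by rewrite perm_rcons perm_cons perm_map.
exists s; split.
- by rewrite (perm_size perm_s) /= size_map size_enum_ord.
- rewrite /vsum (perm_big _ perm_s) big_cons big_map big_enum (eq_bigl xpredT) //=.
  have vsqD h : vsq (z h) = vsq w + (w^T *m t h + (t h)^T *m w) + vsq (t h).
    by rewrite /vsq /z [(_ + _)^T]linearD /= mulmxDl !mulmxDr !addrA.
  under eq_bigr => h _ do rewrite vsqD.
  have sum_tT : \sum_h (t h)^T = 0 by rewrite -[RHS]trmx0 -sum_t [RHS]linear_sum.
  have sum_wt : \sum_h w^T *m t h = 0 by rewrite -mulmx_sumr sum_t mulmx0.
  have sum_tw : \sum_h (t h)^T *m w = 0 by rewrite -mulmx_suml sum_tT mul0mx.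
  rewrite !big_split /= sum_wt sum_tw !addr0.
  rewrite sumr_const card_ord addrA; suff -> : vsq w + vsq w *+ p = 0 by rewrite add0r.
  by rewrite -scaler_nat F2_natr odd_p scale1r mx_addxx.
have zerosP y : y \in rcons [seq z h | h <- zeros] w ->
    y = w \/ exists2 h, l h = 0 /\ dotv (t h) w = 0 & y = z h.
  rewrite mem_rcons inE => /orP[/eqP | /mapP[h]]; first by left.
  rewrite mem_enum inE => /andP[/eqP lh hj] ->.
  right; exists h => //; split=> //; rewrite tw (negPf hj) orbF.
  by rewrite (_ : h == i = false) //; apply: contra_eqF lh => /eqP ->; rewrite li.
have onesP y : y \in [seq z h | h <- ones] ->
    exists2 h, l h = 1 /\ dotv (t h) w = 0 & y = z h.
  case/mapP=> h; rewrite mem_enum inE => /andP[/eqP lh hi] ->.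
  exists h => //; split=> //; rewrite tw (negPf hi) /=.
  by rewrite (_ : h == j = false) //; apply: contra_eqF lh => /eqP ->; rewrite lj.
have r0 : {in rcons [seq z h | h <- zeros] w &, forall u v, dotv u v = 0}.
  move=> u v /zerosP[-> | [g [lg wg] ->]] /zerosP[-> | [h [lh wh] ->]] //.
  - by rewrite dotw.
  - by rewrite dotvC dotw.
  - by rewrite dotE lg wg wh mul0r !addr0.
have pr : {in rcons [seq z h | h <- zeros] w, forall v, dotv (z i) v = 1}.
  move=> v /zerosP[-> | [h [lh wh] ->]]; first by rewrite dotvC dotw tw eqxx.
  by rewrite dotE lh wh tw eqxx mulr0 addr0 add0r.
have qr : {in rcons [seq z h | h <- zeros] w, forall v, dotv (z j) v = 1}.
  move=> v /zerosP[-> | [h [lh wh] ->]]; first by rewrite dotvC dotw tw eqxx orbT.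
  by rewrite dotE lh wh tw eqxx orbT mulr0 addr0 add0r.
have pp : dotv (z i) (z i) = 1 by rewrite dotE -addrA F2_addxx addr0 F2_mulxx.
have qq : dotv (z j) (z j) = 0 by rewrite dotE -addrA F2_addxx addr0 F2_mulxx.
have pq : dotv (z i) (z j) = 0 by rewrite dotE lj !tw !eqxx orbT mulr0 -addrA F2_addxx addr0.
(* The number of even t_h is odd, since p is odd and the l_h sum to 0; dropping j and adding w keeps
   the count. *)
have odd_r : odd (size (rcons [seq z h | h <- zeros] w)).
  rewrite size_rcons size_map -cardE /=.
  have : \sum_h (1 + l h) = 1.
    by rewrite big_split /= sum_l addr0 sumr_const card_ord F2_natr odd_p.
  rewrite (bigD1 j) //= lj addr0.
  have -> : \sum_(h | h != j) (1 + l h) = #|[pred h | (l h == 0) && (h != j)]|%:R.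
    rewrite -sumr_const big_mkcondl; apply: eq_bigr => h _.
    by case: (F2P (l h)) => ->; apply/eqP.
  by rewrite F2_natr; case: (odd _) => //; rewrite F2_addxx => /esym/eqP; rewrite oner_eq0.
apply: unit_suffixes_cat => [|r' r'r].
  rewrite /= -/(z i) -/(z j) (@vsum_even_family_unit _ _ _ _ odd_r r0 pp pr qq pq qr [::]) //=.
  rewrite vsum_odd_isotropic_unit //= -[rcons _ _]cats0.
  apply: unit_suffixes_cat => [|r'' sub]; first by rewrite /= /vsum big_nil addr0 unitmx1.
  by rewrite cats0; apply: totally_isotropic_unit => u v /sub ur /sub vr; apply: r0.
apply: vsum_even_family_unit => //.
- move=> u v /r'r/onesP[g [lg wg] ->] /zerosP[-> | [h [lh wh] ->]].
    by rewrite dotvC dotw.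
  by rewrite dotE lg lh wg wh mulr0 !addr0.
- move=> u v /r'r/onesP[g [lg wg] ->] /r'r/onesP[h [lh wh] ->].
  by rewrite dotE lg lh wg wh mulr1 !addr0.
- move=> u /r'r/onesP[g [lg wg] ->].
  by rewrite !dotE lg li lj wg !tw !eqxx orbT mulr0 mulr1 !addr0 add0r F2_addxx.
Qed.

End Walks.

(** * Self-dual codes and their shortened bases *)

Lemma dotv_under n (y z : 'rV[F2]_n.+1) :
  dotv y z = dotv (under y) (under z) + y 0 ord_max * z 0 ord_max.
Proof.
rewrite !dotv_sum big_ord_recr /=; congr (_ + _).
by apply: eq_bigr => i _; rewrite !mxE.
Qed.

Lemma underE n (y : 'rV[F2]_n.+1) : under y = colsub (widen_ord (leqnSn n)) y.
Proof. by apply/rowP => i; rewrite !mxE. Qed.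

Lemma under_mul m n (c : 'rV[F2]_m) (B : 'I_m -> 'rV[F2]_n.+1) :
  under (c *m fam_mx B) = c *m fam_mx (fun i => under (B i)).
Proof.
rewrite underE -mulmx_colsub; congr (_ *m _); apply/row_matrixP => i.
by rewrite rowK underE; apply/rowP => j; rewrite !mxE.
Qed.

Lemma eq_row_under n (y z : 'rV[F2]_n.+1) :
  under y = under z -> y 0 ord_max = z 0 ord_max -> y = z.
Proof.
move=> /rowP eq_u eq_last; apply/rowP => j.
have [i -> | -> //] := unliftP ord_max j.
have -> : lift ord_max i = widen_ord (leqnSn n) i by apply/val_inj; apply: lift_max.
by have := eq_u i; rewrite !mxE.
Qed.

Lemma dual_codeP N (C : {set 'rV[F2]_N}) y :
  reflect (forall x, x \in C -> dotv x y = 0) (y \in dual_code C).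
Proof.
rewrite inE; apply: (iffP forallP) => [Cy x xC | Cy x].
  by have /implyP/(_ xC)/eqP := Cy x.
by apply/implyP => xC; rewrite Cy.
Qed.

Section Basis.

Variables (m n : nat) (C : {set 'rV[F2]_n.+1}) (B : 'I_m -> 'rV[F2]_n.+1).
Hypotheses (sdC : self_dual C) (basisB : is_basis C B).

Let Y := fam_mx (fun i => under (B i)).

Let C_perp y z : y \in C -> z \in C -> dotv y z = 0.
Proof. by move=> yC; rewrite sdC => /dual_codeP; apply. Qed.

Lemma self_dual_last y : y \in C -> y 0 ord_max = dotv (under y) (under y).
Proof.
move=> yC; have := C_perp yC yC; rewrite dotv_under F2_mulxx.
by move/F2_add_eq0.
Qed.

Let spanC c : c *m fam_mx B \in C.
Proof. by apply/(proj2 basisB); rewrite submxMl. Qed.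

(** Deleting the last entry is injective on C, since that entry is the parity of the others. *)
Lemma row_free_under : row_free Y.
Proof.
apply: row_free_ker => c cY; have uc : under (c *m fam_mx B) = 0 by rewrite under_mul.
have : c *m fam_mx B = 0.
  apply: eq_row_under; first by rewrite uc; apply/rowP => j; rewrite !mxE.
  by rewrite (self_dual_last (spanC c)) uc dot0v mxE.
by move/eqP; rewrite mulmx_free_eq0 ?(proj1 basisB) // => /eqP.
Qed.

Lemma self_dualE y :
  y \in C <-> (under y <= Y)%MS /\ y 0 ord_max = dotv (under y) (under y).
Proof.
split=> [yC | [/submxP[c uy] ly]].
  split; last exact: self_dual_last.
  by have /(proj2 basisB)/submxP[c ->] := yC; rewrite under_mul submxMl.
suff -> : y = c *m fam_mx B by [].
apply: eq_row_under; first by rewrite uy under_mul.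
by rewrite ly (self_dual_last (spanC c)) under_mul -uy.
Qed.

Lemma flat_under : flat [pred u | (u <= Y)%MS].
Proof.
move=> u v; rewrite !inE => /submxP[c ->] /submxP[d ->]; rewrite -!under_mul.
rewrite -!self_dual_last //; apply: F2_add_eq0.
by rewrite -dotv_under C_perp.
Qed.

(** Self-orthogonal words are even, so the all-ones word is orthogonal to C and hence lies in C. *)
Lemma ones_under : exists c : 'I_m -> F2, const_mx 1 = \sum_i c i *: under (B i).
Proof.
have C1 : const_mx 1 \in C.
  by rewrite sdC; apply/dual_codeP => x xC; rewrite -dotv_diag C_perp.
have /(proj2 basisB)/submxP[c cE] := C1; exists (fun i => c 0 i).
have -> : const_mx 1 = under (const_mx 1 : 'rV[F2]_n.+1) by apply/rowP => j; rewrite !mxE.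
by rewrite cE under_mul mulmx_sum_row; apply: eq_bigr => i _; rewrite rowK.
Qed.

End Basis.

Lemma dual_family m n (Y : 'I_m -> 'rV[F2]_n) (a : 'I_m -> F2) : row_free (fam_mx Y) ->
  exists w, forall h, dotv (Y h) w = a h.
Proof.
case/row_freeP=> R YR; exists (R *m \col_h a h)^T => h.
have -> : Y h = row h (fam_mx Y) by rewrite rowK.
by rewrite /dotv trmxK mulmxA -row_mul YR row1 -rowE !mxE.
Qed.

Lemma gram_eqmx m n (Y : 'M[F2]_(m, n)) (K : 'M[F2]_m) : row_free Y -> K \in unitmx ->
  (Y^T *m K *m Y :=: Y)%MS.
Proof.
move=> freeY uK; apply/eqmxP; have le : (Y^T *m K *m Y <= Y)%MS by rewrite submxMl.
have [_ eq_rk] := mxrank_leqif_sup le; rewrite le -eq_rk mxrankMfree //.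
by rewrite mxrankMfree ?row_free_unit // mxrank_tr eqxx.
Qed.

Lemma vsq_mul m n (v : 'rV[F2]_m) (Y : 'M[F2]_(m, n)) : vsq (v *m Y) = Y^T *m vsq v *m Y.
Proof. by rewrite /vsq trmx_mul !mulmxA. Qed.

Lemma fam_mx_gram m n (Y : 'I_m -> 'rV[F2]_n) :
  \sum_i vsq (Y i) = (fam_mx Y)^T *m fam_mx Y.
Proof. by rewrite trmx_mul_rows; apply: eq_bigr => i _; rewrite rowK. Qed.

Lemma sum_fam_mx m n (Y : 'I_m -> 'rV[F2]_n) : \sum_i Y i = const_mx 1 *m fam_mx Y.
Proof.
by rewrite mulmx_sum_row; apply: eq_bigr => i _; rewrite rowK mxE scale1r.
Qed.

Lemma even_lastE m n (B : 'I_m -> 'rV[F2]_n.+1) :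
  even_last B = (\sum_i B i 0 ord_max == 0).
Proof.
have -> : \sum_i B i 0 ord_max = #|[set i | B i 0 ord_max == 1]|%:R.
  rewrite -sumr_const [RHS]big_mkcond; apply: eq_bigr => i _; rewrite inE.
  by case: (F2P (B i 0 ord_max)) => ->.
by rewrite F2_natr /even_last; case: (odd _).
Qed.

(** Brings both kinds of matrix to common data. Disjointness uses that the row space of A - I
    determines C; the inclusion uses flatness, the rank and the list of m + 2 vectors. *)
Lemma FC_structure n (C : {set 'rV[F2]_n.+1}) A (m := (n + 1)./2) :
    odd n -> self_dual C -> in_FC C A ->
  exists Y : 'M[F2]_(m, n), exists s,
   [/\ row_free Y /\ (A - 1%:M :=: Y)%MS, flat [pred u | (u <= Y)%MS],
     ((const_mx 1 : 'rV_n) <= Y)%MS,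
     forall y, y \in C <-> (under y <= Y)%MS /\ y 0 ord_max = dotv (under y) (under y)
   & [/\ size s = m.+2, A = 1%:M + vsum s & unit_suffixes s]].
Proof.
move=> odd_n sdC; rewrite /in_FC -/m => FCA.
pose Y (B : 'I_m -> 'rV[F2]_n.+1) i := under (B i).
have Yle B i : (Y B i <= fam_mx (Y B))%MS by rewrite -[Y B i](rowK (Y B)) row_sub.
suff [B [basisB eqA [s [size_s AE us]]]] : exists B : 'I_m -> 'rV[F2]_n.+1,
    [/\ is_basis C B, (A - 1%:M :=: fam_mx (Y B))%MS
      & exists s, [/\ size s = m.+2, A = 1%:M + vsum s & unit_suffixes s]].
  exists (fam_mx (Y B)), s; split=> //.
  - by split; [apply: (row_free_under sdC basisB) | exact: eqA].
  - exact: flat_under sdC basisB.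
  - have [c ->] := ones_under sdC basisB.
    by apply: summx_sub => i _; apply: scalemx_sub (Yle B i).
  - exact: self_dualE sdC basisB.
case: FCA => [[B [basisB [evB AE]]] | [even_m [B [basisB AE]]]]; exists B.
  have freeY := row_free_under sdC basisB; have flatY := flat_under sdC basisB.
  have [c ones] := ones_under sdC basisB.
  have AE' : A = 1%:M + \sum_i vsq (Y B i) by [].
  split=> //.
    rewrite AE' addrC addKr fam_mx_gram -[_^T]mulmx1.
    exact: gram_eqmx (unitmx1 _ _).
  have [|||s [size_s sE us]] := odd_family_walk odd_n (t := Y B) _ ones.
  - by move=> i j; apply: flatY; rewrite inE Yle.
  - by move=> i; apply: dual_family.
  - under eq_bigr => i _.
      have Bi : B i \in C by apply/(proj2 basisB); rewrite -[B i](rowK B) row_sub.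
      rewrite -(self_dual_last sdC Bi); over.
    by move: evB; rewrite even_lastE => /eqP.
  by exists s; rewrite AE' sE.
have freeY := row_free_under sdC basisB; have flatY := flat_under sdC basisB.
have [c ones] := ones_under sdC basisB.
(* The basis extended by its sum: m + 1 vectors, an odd number, with total 0. The all-ones vector
   gets coefficient 0 on the extra one. *)
pose t (h : 'I_m.+1) := oapp (Y B) (\sum_i Y B i) (unlift ord0 h).
pose c' (h : 'I_m.+1) := oapp c 0 (unlift ord0 h).
have t0 : t ord0 = \sum_i Y B i by rewrite /t unlift_none.
have tS i : t (lift ord0 i) = Y B i by rewrite /t liftK.
have AE' : A = 1%:M + \sum_h vsq (t h).
  rewrite big_ord_recl t0; under [X in _ + (_ + X)]eq_bigr => i _ do rewrite tS.
  by rewrite AE /A2 -addrA; congr (_ + _); rewrite addrC.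
split=> //.
  rewrite AE /A2 -(addrA 1%:M) [1%:M + _]addrC addrK fam_mx_gram sum_fam_mx vsq_mul.
  rewrite -{1}[(fam_mx _)^T]mulmx1 -mulmxDl -mulmxDr; apply: gram_eqmx freeY _.
  (* The Gram factor is I + 1^T 1, invertible because the all-ones vector of even length m is
     isotropic. *)
  have := @vsum1_unit _ (const_mx 1 : 'rV[F2]_m); rewrite /vsum big_seq1; apply.
  by rewrite const1_dot F2_natr (negPf even_m).
have [|||||s [size_s sE us]] := even_family_walk odd_n (t := t) (c := c').
- move=> h g; apply: flatY; rewrite inE.
    by rewrite /t; case: unliftP => [i|] _ /=; rewrite ?Yle // summx_sub.
  by rewrite /t; case: unliftP => [i|] _ /=; rewrite ?Yle // summx_sub.
- rewrite big_ord_recl /c' unlift_none scale0r add0r ones.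
  by apply: eq_bigr => i _; rewrite liftK tS.
- by rewrite /= even_m.
- rewrite big_ord_recl t0; under [X in _ + X]eq_bigr => i _ do rewrite tS.
  exact: mx_addxx.
- move=> i j neqij.
  (* Prescribing w on the basis suffices: the values over all m + 1 indices must add up to 0, and
     exactly two of them are 1. *)
  have [w Yw] := dual_family (fun h => ((lift ord0 h == i) || (lift ord0 h == j))%:R) freeY.
  exists w => h; rewrite /t; case: unliftP => [g ->|->] /=; first exact: Yw.
  rewrite dotv_suml; under eq_bigr => g _ do rewrite Yw.
  apply: F2_add_eq0; rewrite addrC.
  rewrite -(big_ord_recl m (fun h : 'I_m.+1 => ((h == i) || (h == j))%:R)).
  rewrite (bigD1 i) //= (bigD1 j) 1?eq_sym //= !eqxx orbT addrA F2_addxx add0r.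
  by rewrite big1 // => g /andP[/negPf -> /negPf ->].
by exists s; rewrite AE' sE.
Qed.

(** * Gram factorisations and the non-flat case *)

Lemma sym_rank_factor n r (D : 'M[F2]_n) : D^T = D -> \rank D = r ->
  exists X : 'M[F2]_(r, n), exists S : 'M[F2]_r,
    [/\ row_free X, D = X^T *m S *m X, S^T = S & S \in unitmx].
Proof.
move=> symD rkD; have: exists X : 'M[F2]_(\rank D, n), row_free X /\ (D <= X)%MS.
  by exists (row_base D); rewrite row_base_free eq_row_base.
rewrite rkD => -[X [freeX /submxP[W DW]]]; have /row_freeP[R XR] := freeX.
have WE : W = X^T *m (W^T *m R).
  by rewrite mulmxA -trmx_mul -DW symD DW -mulmxA XR mulmx1.
have DE : D = X^T *m (W^T *m R) *m X by rewrite -WE.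
have RX : R^T *m X^T = 1%:M by rewrite -trmx_mul XR trmx1.
have cancelX (S1 S2 : 'M_r) : X^T *m S1 *m X = X^T *m S2 *m X -> S1 = S2.
  move/(congr1 (fun A => R^T *m (A *m R))).
  by rewrite -!mulmxA XR !mulmx1 !(mulmxA R^T) RX !mul1mx.
exists X; move: (W^T *m R) DE => S DE; exists S; split=> //.
  apply: cancelX; rewrite -DE -[RHS]symD [in RHS]DE.
  by rewrite !trmx_mul trmxK mulmxA.
rewrite -row_free_unit -row_leq_rank -{1}rkD {1}DE.
exact: leq_trans (mxrankM_maxl _ _) (mxrankM_maxr _ _).
Qed.

Lemma sum_of_squares k (K : 'M[F2]_k) : K^T = K -> K \in unitmx ->
  (exists x, bform K x x = 1) -> exists R : 'M[F2]_k, K = R^T *m R /\ R \in unitmx.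
Proof.
move=> symK uK nonalt; have [P PK] := orthonormal_basis symK uK (or_intror nonalt).
have [uP _] : P \in unitmx /\ K *m P^T \in unitmx by apply: mulmx1_unit; rewrite mulmxA.
exists (invmx P)^T; rewrite trmxK unitmx_tr unitmx_inv uP; split=> //.
rewrite -{1}[invmx P]mulmx1 -PK -!mulmxA mulKmx // trmx_inv mulmxV ?mulmx1 //.
by rewrite unitmx_tr.
Qed.

(** The extra unit block makes the form non-alternate, so a factorisation exists whether or not [S]
    is alternate. *)
Lemma sum_of_squares_succ k (S : 'M[F2]_k) : S^T = S -> S \in unitmx ->
  exists R : 'M[F2]_(k + 1), block_mx S 0 0 1%:M = R^T *m R /\ R \in unitmx.
Proof.
move=> symS uS; apply: sum_of_squares.
- by rewrite tr_block_mx symS !trmx0 trmx1.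
- by rewrite unitmxE det_lblock det1 mulr1 -unitmxE.
exists (row_mx 0 1%:M); rewrite /bform mul_row_block !mul0mx !mulmx0 !mul1mx !add0r.
by rewrite tr_row_mx mul_row_col mul0mx add0r trmx1 mulmx1 mxE.
Qed.

Lemma nonflat_walk n r (D : 'M[F2]_n) (u v : 'rV[F2]_n) : D^T = D -> \rank D = r ->
    1%:M + D \in unitmx -> (u <= D)%MS -> (v <= D)%MS ->
    dotv u v <> dotv u u * dotv v v ->
  exists2 j, (j <= r.+1)%N & walk j (1%:M + D) 1%:M.
Proof.
move=> symD rkD uA uD vD neq; have [X [S [freeX DE symS uS]]] := sym_rank_factor symD rkD.
have [R [SR uR]] := sum_of_squares_succ symS uS.
pose T := R *m col_mx X 0.
have TT : T^T *m T = D.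
  rewrite trmx_mul mulmxA -(mulmxA _ R^T) -SR tr_col_mx mul_row_block !mulmx0 !addr0.
  by rewrite trmx0 mul_row_col mulmx0 addr0 -DE.
have GE a b : bform (T *m invmx 1%:M *m T^T) a b = dotv (a *m T) (b *m T).
  by rewrite bform_mx invmx1 -dotvE.
have symG : (T *m invmx 1%:M *m T^T)^T = T *m invmx 1%:M *m T^T.
  by rewrite trmx_congruence // invmx1 trmx1.
have lift_row w : (w <= D)%MS -> exists a : 'rV_(r + 1), a *m T = w.
  move=> wD; have /submxP[c ->] : (w <= X)%MS.
    by apply: submx_trans wD _; rewrite DE submxMl.
  by exists (row_mx c 0 *m invmx R); rewrite mulmxA mulmxKV // mul_row_col mulmx0 addr0.
have [a aT] := lift_row u uD; have [b bT] := lift_row v vD.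
have s1 : sgl (1%:M : 'M[F2]_n) by rewrite /sgl trmx1 eqxx unitmx1.
have [|||j le_j wj] := short_walk (T := T) s1.
- by rewrite TT.
(* The padding coordinate e is fixed by the block matrix, so e R^T is a unit vector killed by T.
   There G vanishes and I + G takes the value 1. *)
- right; pose e : 'rV[F2]_(r + 1) := row_mx 0 1%:M; exists (e *m R^T).
  have eS : e *m block_mx S 0 0 1%:M = e.
    by rewrite mul_row_block !mul0mx !mulmx0 !mul1mx !add0r.
  rewrite bform_addl GE -dotvE mulmxA -(mulmxA e) -SR eS.
  rewrite mul_row_col mul0mx mulmx0 addr0 dot0v addr0 /dotv trmx_mul trmxK mulmxA.
  rewrite -(mulmxA e) -SR eS tr_row_mx mul_row_col trmx0 mul0mx add0r.
  by rewrite trmx1 mulmx1 mxE.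
- by move=> _; exists a, b; rewrite bform_alt // !GE aT bT; apply: F2_neq_add.
by exists j; [rewrite -addn1 | rewrite -TT].
Qed.

(** * Parity extension of a flat space, and recovery of the code *)

Section Extension.

Variable n : nat.

Definition ext (u : 'rV[F2]_n) : 'rV[F2]_n.+1 :=
  \row_(j < n.+1) (if unlift ord_max j is Some k then u 0 k else dotv u u).

Lemma ext_last u : ext u 0 ord_max = dotv u u.
Proof. by rewrite mxE unlift_none. Qed.

Lemma under_ext u : under (ext u) = u.
Proof.
apply/rowP => j; rewrite !mxE.
have -> : widen_ord (leqnSn n) j = lift ord_max j by apply/val_inj/esym/lift_max.
by rewrite liftK.
Qed.

Lemma dotv_ext u v : dotv (ext u) (ext v) = dotv u v + dotv u u * dotv v v.
Proof. by rewrite dotv_under !under_ext !ext_last. Qed.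

Lemma ext_under (y : 'rV[F2]_n.+1) : y 0 ord_max = dotv (under y) (under y) -> y = ext (under y).
Proof. by move=> y_last; apply: eq_row_under; rewrite ?under_ext ?ext_last. Qed.

(** Appending the parity is linear because u.u is linear in u. *)
Lemma ext_sum m (c : 'rV[F2]_m) (X : 'M[F2]_(m, n)) :
  c *m fam_mx (fun i => ext (row i X)) = ext (c *m X).
Proof.
have famX : fam_mx (fun i => under (ext (row i X))) = X.
  by apply/row_matrixP => i; rewrite rowK under_ext.
apply: eq_row_under; first by rewrite under_mul famX under_ext.
rewrite ext_last dotv_diag mulmx_sum_row [in RHS]mulmx_sum_row dotv_suml summxE.
by apply: eq_bigr => i _; rewrite mxE rowK ext_last dotvZl dotv_diag.
Qed.

Definition ext_code (D : 'M[F2]_n) : {set 'rV[F2]_n.+1} :=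
  [set y | (under y <= D)%MS && (y 0 ord_max == dotv (under y) (under y))].

Lemma mem_ext_code D u : (ext u \in ext_code D) = (u <= D)%MS.
Proof. by rewrite inE under_ext ext_last eqxx andbT. Qed.

Lemma ext_code_basis m (D : 'M[F2]_n) (X : 'M[F2]_(m, n)) : row_free X -> (X :=: D)%MS ->
  is_basis (ext_code D) (fun i => ext (row i X)).
Proof.
move=> freeX eqX; split.
  apply: row_free_ker => c; rewrite ext_sum => cX0.
  have : c *m X = 0 by rewrite -[c *m X]under_ext cX0; apply/rowP => j; rewrite !mxE.
  by move/eqP; rewrite mulmx_free_eq0 // => /eqP.
move=> y; split.
  rewrite inE -eqX => /andP[/submxP[c uy] /eqP/ext_under ->].
  by rewrite uy -ext_sum submxMl.
by case/submxP=> c ->; rewrite ext_sum mem_ext_code -eqX submxMl.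
Qed.

(** Flatness makes the code self-orthogonal; equality with the dual follows from dimension m in
    length 2m. *)
Lemma ext_code_self_dual m (D : 'M[F2]_n) (X : 'M[F2]_(m, n)) :
    n.+1 = (m + m)%N -> row_free X -> (X :=: D)%MS -> flat [pred u | (u <= D)%MS] ->
  self_dual (ext_code D).
Proof.
move=> n2m freeX eqX flatD; have [freeB basisB] := ext_code_basis freeX eqX.
set B := fam_mx _ in freeB basisB.
have perp y z : y \in ext_code D -> z \in ext_code D -> dotv y z = 0.
  rewrite !inE => /andP[uy /eqP/ext_under ->] /andP[uz /eqP/ext_under ->].
  by rewrite dotv_ext flatD // F2_addxx.
apply/setP => y; apply/idP/dual_codeP => [yC x xC | yC]; first exact: perp.
have leB : (B <= kermx B^T)%MS.
  apply/sub_kermxP/matrixP => i j; rewrite [RHS]mxE.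
  have rowC h : row h B \in ext_code D by apply/basisB; rewrite row_sub.
  rewrite -(perp _ _ (rowC i) (rowC j)) dotv_sum mxE.
  by apply: eq_bigr => k _; rewrite !mxE.
have kerB : (kermx B^T <= B)%MS.
  have [_ <-] := mxrank_leqif_sup leB.
  by rewrite mxrank_ker mxrank_tr (eqP freeB) {1}n2m addnK.
apply/basisB; apply: submx_trans kerB.
apply/sub_kermxP/matrixP => i j; rewrite [RHS]mxE ord1.
rewrite -(yC (row j B)); last by apply/basisB; rewrite row_sub.
by rewrite dotvC dotv_sum mxE; apply: eq_bigr => k _; rewrite !mxE.
Qed.

End Extension.

Lemma eqmxMunit m n (R : 'M[F2]_m) (X : 'M[F2]_(m, n)) : R \in unitmx -> (R *m X :=: X)%MS.
Proof. by move=> uR; apply: eqmxMfull; rewrite row_full_unit. Qed.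

Lemma row_freeMunit m n (R : 'M[F2]_m) (X : 'M[F2]_(m, n)) :
  R \in unitmx -> row_free X -> row_free (R *m X).
Proof. by move=> uR; rewrite /row_free (eqmxMunit X uR). Qed.

(** If the sum were 1, the vector l of parities would give a nonzero lX fixed by X^T X, hence in the
    kernel of I + X^T X. *)
Lemma flat_unit_even m n (X : 'M[F2]_(m, n)) : row_free X -> flat [pred u | (u <= X)%MS] ->
  1%:M + X^T *m X \in unitmx -> \sum_i dotv (row i X) (row i X) = 0.
Proof.
move=> freeX flatX uA; pose l := \row_i dotv (row i X) (row i X).
case: (F2P (\sum_i dotv (row i X) (row i X))) => // sum1.
have lX j : dotv (l *m X) (row j X) = l 0 j.
  rewrite mulmx_sum_row dotv_suml -[RHS]mul1r -sum1 big_distrl /=.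
  apply: eq_bigr => i _; rewrite dotvZl flatX ?inE ?row_sub // !mxE mulrA.
  by rewrite F2_mulxx.
have : l *m X = 0.
  apply: unitmx_inj uA _; rewrite mulmxDr mulmx1 trmx_mul_rows mulmx_sumr.
  under [X in _ + X]eq_bigr => j _ do rewrite mul_vsq lX.
  by rewrite -mulmx_sum_row mx_addxx.
move/eqP; rewrite mulmx_free_eq0 // => /eqP l0.
by rewrite big1 // => i _; have /rowP/(_ i) := l0; rewrite !mxE.
Qed.

Lemma flat_in_FC n (A : 'M[F2]_n) (m := (n + 1)./2) : n.+1 = (m + m)%N -> sgl A ->
    \rank (A - 1%:M) = m -> flat [pred u | (u <= A - 1%:M)%MS] ->
  in_FC (ext_code (A - 1%:M)) A /\ self_dual (ext_code (A - 1%:M)).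
Proof.
move=> n2m /andP[/eqP symA uA] rkD flatD; set D := A - 1%:M in rkD flatD *.
have symD : D^T = D by rewrite linearB /= symA trmx1.
have AE : A = 1%:M + D by rewrite addrC subrK.
have [X [S [freeX DE symS uS]]] := sym_rank_factor symD rkD.
have eqX : (X :=: D)%MS.
  by rewrite DE; apply/eqmx_sym/gram_eqmx.
split; last exact: ext_code_self_dual n2m freeX eqX flatD.
have basisX R : R \in unitmx -> is_basis (ext_code D) (fun i => ext (row i (R *m X))).
  move=> uR; apply: ext_code_basis; first exact: row_freeMunit.
  exact: eqmx_trans (eqmxMunit X uR) eqX.
have famX (Z : 'M[F2]_(m, n)) : fam_mx (fun i => under (ext (row i Z))) = Z.
  by apply/row_matrixP => i; rewrite rowK under_ext.
have [alt | nonalt] := alternateP symS; last first.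
  have [R [SR uR]] := sum_of_squares symS uS nonalt.
  have RD : (R *m X)^T *m (R *m X) = D.
    by rewrite trmx_mul mulmxA -(mulmxA _ R^T) -SR -DE.
  left; exists (fun i => ext (row i (R *m X))); split; first exact: basisX.
  split; last by rewrite /A1 fam_mx_gram famX RD.
  rewrite even_lastE; under eq_bigr => i _ do rewrite ext_last.
  apply/eqP/flat_unit_even; first exact: row_freeMunit.
    by move=> u v; rewrite !inE !(eqmxMunit X uR) !eqX; apply: flatD.
  by rewrite RD -AE.
right; split; first exact: unit_alternate_even alt.
have [R [SR uR]] := sum_of_squares_succ symS uS.
have [P [q SPq]] : exists (P : 'M[F2]_m) (q : 'rV_m), S = P^T *m P + vsq q.
  exists (ulsubmx R), (dlsubmx R); have := congr1 ulsubmx SR; rewrite block_mxKul => ->.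
  by rewrite -{1 2}[R]submxK tr_block_mx mulmx_block block_mxKul.
(* The diagonal of P^T P is the sum of the rows of P and that of q^2 is q; they agree because S has
   zero diagonal. Thus the extra square is the square of the sum, as in [A2]. *)
have qP : const_mx 1 *m P = q.
  apply: mx_add_eq0; apply/rowP => j; rewrite [RHS]mxE.
  have Sjj : S j j = 0 by have /rowP/(_ j) := alt; rewrite !mxE.
  rewrite -[RHS]Sjj SPq mxE [RHS]mxE; congr (_ + _); rewrite !mxE.
    by apply: eq_bigr => i _; rewrite !mxE mul1r F2_mulxx.
  by rewrite big_ord1 !mxE F2_mulxx.
have uP : P \in unitmx.
  move: uS; rewrite SPq -qP vsq_mul -{1}[P^T]mulmx1 -mulmxDl -mulmxDr unitmx_mul.
  by case/andP.
exists (fun i => ext (row i (P *m X))); split; first exact: basisX.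
rewrite /A2 fam_mx_gram sum_fam_mx famX (mulmxA (const_mx 1)) qP vsq_mul -addrA AE; congr (_ + _).
by rewrite trmx_mul mulmxA -(mulmxA _ P^T) -mulmxDl -mulmxDr -SPq.
Qed.

Theorem theorem8p3 (n : nat) (hn : (3 <= n)%N) (hodd : odd n) :
  (forall C : {set 'rV['F_2]_n.+1}, self_dual C ->
     forall A : 'M['F_2]_n, in_FC C A -> in_SD A)
  /\ (forall C C' : {set 'rV['F_2]_n.+1}, self_dual C -> self_dual C' -> C <> C' ->
        forall A : 'M['F_2]_n, ~ (in_FC C A /\ in_FC C' A))
  /\ (forall A : 'M['F_2]_n, in_SD A ->
        exists C : {set 'rV['F_2]_n.+1}, self_dual C /\ in_FC C A).
Proof.
have n2m : n.+1 = ((n + 1)./2 + (n + 1)./2)%N.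
  by rewrite addnn -[in LHS]addn1 -[LHS]odd_double_half addn1 /= hodd.
have m2 : (n + 5)./2 = (n + 1)./2.+2 by rewrite !addnS.
split=> [C sdC A FCA | ].
  have [Y [s [[freeY eqY] flatY Y1 _ [size_s AE us]]]] := FC_structure hodd sdC FCA.
  have sA : sgl A by rewrite AE sgl_vsum unit_suffixes_unit.
  have rkA : \rank (A - 1%:M) = (n + 1)./2 by rewrite eqY (eqP freeY).
  have long j : walk j A 1%:M -> ((n + 5)./2 <= j)%N.
    move=> wj; have [s' [size_s' AE' us']] := walk_vsum sA wj.
    have DE : A - 1%:M = vsum s' by rewrite AE' addrC addKr.
    rewrite m2 -size_s' -rkA DE -addn2; apply: flat_walk_long us'; rewrite -DE.
      by move=> u v; rewrite !inE !eqY; apply: flatY.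
    by exists (const_mx 1); rewrite eqY const1_dot F2_natr hodd.
  split=> //; split=> //; split; last first.
    by move=> j lt_j wj; move: (long j wj); rewrite leqNgt lt_j.
  have [j le_j] := vsum_walk us; rewrite -AE => wj.
  suff -> : (n + 5)./2 = j by [].
  by apply/eqP; rewrite eqn_leq long // m2 -size_s.
split=> [C C' sdC sdC' neqC A [FCA FCA'] | A [sA [[wA longA] rkA]]].
  case: neqC.
  have [Y [s [[_ eqY] _ _ CE _]]] := FC_structure hodd sdC FCA.
  have [Y' [s' [[_ eqY'] _ _ CE' _]]] := FC_structure hodd sdC' FCA'.
  by apply/setP => y; apply/idP/idP => [/CE | /CE']; rewrite -?eqY -?eqY' => yY;
    [apply/CE' | apply/CE]; rewrite -?eqY -?eqY'.
(* A non-flat row space would give a walk of length at most m + 1, below the distance m + 2. *)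
have flatD : flat [pred u | (u <= A - 1%:M)%MS].
  move=> u v; rewrite !inE => uD vD; apply/eqP/negPn/negP => /eqP neq.
  have /andP[/eqP symA uA] := sA.
  have AE : 1%:M + (A - 1%:M) = A by rewrite addrC subrK.
  have [||j le_j wj] := nonflat_walk _ rkA _ uD vD neq.
  - by rewrite linearB /= symA trmx1.
  - by rewrite AE.
  by move: wj; rewrite AE; apply: longA; rewrite m2.
have [FCA sdC] := flat_in_FC n2m sA rkA flatD.
by exists (ext_code (A - 1%:M)).
Qed.
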